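(* Consider the step system and let $h>h^{step}$. For level sets $(e_1,h-e_1)\in\mathcal{R}^c(h)$ for which $\Theta_2=\frac{2\pi m}{n}$ (with $m,n$ positive integers) and $2\theta_2^{wall}<\frac{2\pi}{n}$, the interval exchange map given by the return map to $\Sigma_1=\{p_1=0,\dot p_1<0\}$ is non-ergodic. For such level sets: if $\{\chi_2\}\notin\mathbb{Q}$, the motion is dense on a union of open intervals and is periodic on its complement; if $\{\chi_2\}\in\mathbb{Q}$, all initial conditions are periodic, yet there are two distinct periods. The conditions $\Theta_2=\frac{2\pi m}{n}$ and $2\theta_2^{wall}<\frac{2\pi}{n}$ together with $\{\chi_2\}\notin\mathbb{Q}$, and the conditions $\Theta_2=\frac{2\pi m}{n}$ and $2\theta_2^{wall}<\frac{2\pi}{n}$ together with $\{\chi_2\}\in\mathbb{Q}$, are all realizable for some level sets and wall positions.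
   Context: Smooth system. $H=H_1(q_1,p_1)+H_2(q_2,p_2)$, $H_i=\frac{p_i^2}{2}+V_i(q_i)$, where each $V_i:\mathbb{R}\to\mathbb{R}$ is $C^\infty$, has a single simple minimum at $0$, $V_i(0)=0$, $qV_i'(q)>0$ for all $q\ne0$, and $V_i(q)\to\infty$ as $|q|\to\infty$. For $e_i>0$, $q_i^{max}(e_i)>0$ is the positive solution of $V_i(q)=e_i$, $T_i(e_i)$ is the period of the orbit $H_i=e_i$. The angle variable $\theta_i$ of $H_i$ satisfies $\dot\theta_i=\omega_i(e_i)=2\pi/T_i(e_i)$ and is normalized so that $\theta_i=0$ on $\{p_i=0,\dot p_i<0\}$. Step and step flow. $S=\{(q_1,q_2): q_1<q_1^{wall}\text{ and }q_2<q_2^{wall}\}$, $q_1^{wall}q_2^{wall}\neq0$. The step system is the Hamiltonian flow of $H$ on $(q_1,q_2)\in\mathbb{R}^2\setminus S$ with elastic reflections: on the 1-boundary ($q_1=q_1^{wall}$, $q_2<q_2^{wall}$) $p_1\to-p_1$, and on the 2-boundary ($q_1<q_1^{wall}$, $q_2=q_2^{wall}$) $p_2\to-p_2$. The energies $e_i=H_i$ are conserved. $h_i^{step}=V_i(q_i^{wall})$, $h^{step}=h_1^{step}+h_2^{step}$, $\mathcal{R}^c(h)=\{(e_1,e_2): e_1\in(h_1^{step},h-h_2^{step}),\ e_2=h-e_1\}$. $\tilde T_i(e_i;q_i^{wall})=2\int_{q_i^{wall}}^{q_i^{max}(e_i)}\frac{dq}{\sqrt{2(e_i-V_i(q))}}$;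 $\theta_2^{wall}=\theta_2^{wall}(h-e_1;q_2^{wall})=\pi\frac{\tilde T_2(h-e_1;q_2^{wall})}{T_2(h-e_1)}$; $\Theta_2=2\pi\frac{\tilde T_1(e_1;q_1^{wall})}{T_2(h-e_1)}$; $\chi_2=\frac{T_1(e_1)-\tilde T_1(e_1;q_1^{wall})}{\tilde T_2(h-e_1;q_2^{wall})}$; $K_2=\lfloor\chi_2\rfloor$; $\{x\}$ is the fractional part. On a level set in $\mathcal{R}^c(h)$ the return map to $\Sigma_1$, written in the coordinate $\theta_2\in\mathbb{R}/2\pi\mathbb{Z}$, is the interval exchange map $F(\theta_2)=\theta_2+\Theta_2$ on $J_R$, $F(\theta_2)=\theta_2+\Theta_2+2\theta_2^{wall}\{\chi_2\}$ on $J_{K_2}$, $F(\theta_2)=\theta_2+\Theta_2-2\theta_2^{wall}(1-\{\chi_2\})$ on $J_{K_2+1}$ (mod $2\pi$), where $J_R,J_{K_2},J_{K_2+1}$ are consecutive intervals in this cyclic order partitioning the circle, of lengths $2\pi-2\theta_2^{wall}$, $2\theta_2^{wall}(1-\{\chi_2\})$, $2\theta_2^{wall}\{\chi_2\}$, with left end point of $J_R$ at $\theta_2^{wall}-\frac12\Theta_2$. Ergodicity is with respect to Lebesgue measure; ''motion'', ''dense'' and ''periodic'' refer to orbits of $F$ on the circle. Realizability: for given potentials $V_1,V_2$, there exist wall positions and level sets satisfying the stated conditions.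
   Formalization: Two distinct periods are claimed only for {χ_2} ≠ 0 (for {χ_2} = 0, F is a rotation with a single period); for irrational {χ_2}, the finitely many left end points of the open intervals belong to the dense part, so periodicity is claimed on the complement of the left-closed intervals. *)

(* Defs.v *)
(* MathComp-Analysis, over an arbitrary [R : realType]. *)
From HB Require Import structures.
From mathcomp Require Import all_boot all_order all_algebra.
From mathcomp Require Import all_classical all_reals all_analysis.

Set Implicit Arguments.
Unset Strict Implicit.
Unset Printing Implicit Defensive.

Import Order.TTheory GRing.Theory Num.Theory.
Import numFieldNormedType.Exports.

Local Open Scope classical_set_scope.
Local Open Scope ring_scope.

(* "Simple" minimum is read as nondegenerate, V''(0) > 0.  That 0 is the only
   critical point and the global minimum follows from the sign condition. *)
Definition admissible_potential (R : realType) (V : R -> R) : Prop :=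
  [/\ forall (n : nat) (x : R), derivable (derive1n n V) x 1,
      V 0 = 0 /\ 0 < derive1n 2 V 0,
      forall q, q != 0 -> 0 < q * derive1 V q,
      V x @[x --> +oo] --> +oo
    & V x @[x --> -oo] --> +oo].

Definition qmax (R : realType) (V : R -> R) (e : R) : R :=
  xget 0 [set q | 0 < q /\ V q = e].

Definition hamiltonian_motion (R : realType) (V : R -> R) (e : R)
    (q p : R -> R) : Prop :=
  [/\ forall t : R, is_derive t (1 : R) q (p t),
      forall t : R, is_derive t (1 : R) p (- derive1 V (q t))
    & forall t : R, p t ^+ 2 / 2 + V (q t) = e].

Definition least_period (R : realType) (q p : R -> R) (T : R) : Prop :=
  [/\ 0 < T,
      forall t, q (t + T) = q t /\ p (t + T) = p t
    & forall s, 0 < s -> (forall t, q (t + s) = q t /\ p (t + s) = p t) ->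
        T <= s].

(* For an admissible potential and e > 0 the curve H = e is a single periodic
   orbit, so the set below is a singleton. *)
Definition period (R : realType) (V : R -> R) (e : R) : R :=
  xget 0 [set T | exists q p, hamiltonian_motion V e q p /\ least_period q p T].

(* The integrand is singular at the right end point, where its value is the
   junk value 0; the Lebesgue integral does not see that point. *)
Definition impact_period (R : realType) (V : R -> R) (e qwall : R) : R :=
  2 * \int[lebesgue_measure]_(q in `[qwall, qmax V e])
        (Num.sqrt (2 * (e - V q)))^-1.

Definition fracpart (R : realType) (x : R) : R := x - (Num.floor x)%:~R.

(* The circle R/2piZ is represented by [0, 2pi[, and [wrap x] is the
   representative of the class of x. *)
Definition circle (R : realType) : set R := [set x | 0 <= x < 2 * pi].

Definition wrap (R : realType) (x : R) : R :=
  x - 2 * pi * (Num.floor (x / (2 * pi)))%:~R.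

(* Arcs of length l starting at (the class of) a and running counterclockwise:
   half-open [a, a + l[ and open ]a, a + l[.  Intended for 0 <= l <= 2pi. *)
Definition circle_arc (R : realType) (a l x : R) : bool := wrap (x - a) < l.

Definition open_circle_arc (R : realType) (a l x : R) : bool := 0 < wrap (x - a) < l.

(* The three exchanged intervals are closed on the left and open on the right;
   J_{K+1} is what is left after J_R and J_K. *)
Definition exchange (R : realType) (Theta thetaw chi x : R) : R :=
  let leftR := thetaw - Theta / 2 in
  let lengthR := 2 * pi - 2 * thetaw in
  let leftK := leftR + lengthR in
  let lengthK := 2 * thetaw * (1 - fracpart chi) in
  wrap (if circle_arc leftR lengthR x then x + Theta
        else if circle_arc leftK lengthK x then x + Theta + 2 * thetaw * fracpart chi
        else x + Theta - 2 * thetaw * (1 - fracpart chi)).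

Section Step.
Variables (R : realType) (V1 V2 : R -> R) (q1wall q2wall : R).

Definition hstep : R := V1 q1wall + V2 q2wall.

Definition Rc (h : R) : set (R * R) :=
  [set e | V1 q1wall < e.1 < h - V2 q2wall /\ e.2 = h - e.1].

Definition theta2wall (e2 : R) : R :=
  pi * (impact_period V2 e2 q2wall / period V2 e2).

Definition Theta2 (e1 e2 : R) : R :=
  2 * pi * (impact_period V1 e1 q1wall / period V2 e2).

Definition chi2 (e1 e2 : R) : R :=
  (period V1 e1 - impact_period V1 e1 q1wall) / impact_period V2 e2 q2wall.

(* The return map to Sigma_1 on the level set (e1, e2), in the coordinate
   theta_2. *)
Definition return_map (e1 e2 : R) : R -> R :=
  exchange (Theta2 e1 e2) (theta2wall e2) (chi2 e1 e2).

End Step.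

(* No measure preservation is built in, so the negation asserts the existence
   of an invariant Borel set that is neither null nor of full measure. *)
Definition ergodic (R : realType) (F : R -> R) : Prop :=
  forall A : set (measurableTypeR R), measurable A -> A `<=` @circle R ->
    @circle R `&` F @^-1` A = A ->
    lebesgue_measure A = 0%E \/ lebesgue_measure (@circle R `\` A) = 0%E.

Definition periodic_point (R : realType) (F : R -> R) (x : R) : Prop :=
  exists2 N : nat, (0 < N)%N & iter N F x = x.

Definition minimal_period (R : realType) (F : R -> R) (x : R) (N : nat) : Prop :=
  [/\ (0 < N)%N, iter N F x = x
    & forall k : nat, (0 < k < N)%N -> iter k F x <> x].

(* Closeness is measured on the circle, i.e. modulo 2pi. *)
Definition dense_orbit_in (R : realType) (F : R -> R) (x : R) (U : set R) : Prop :=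
  forall y : R, U y -> forall eps : R, 0 < eps ->
    exists (k : nat) (j : int), `|iter k F x - y - 2 * pi * j%:~R| < eps.

(* U is the finite union of the open arcs ]a_i, a_i + l_i[ and W adds their
   left end points: since the exchanged intervals are closed on the left, those
   finitely many points follow the dense part. *)
Definition dense_on_arcs_periodic_off (R : realType) (F : R -> R) : Prop :=
  exists (N : nat) (a l : 'I_N.+1 -> R),
    let U := [set x | @circle R x /\ exists i, open_circle_arc (a i) (l i) x] in
    let W := [set x | @circle R x /\ exists i, circle_arc (a i) (l i) x] in
    [/\ forall i, 0 < l i < 2 * pi,
        forall x, W x -> (forall k, W (iter k F x)) /\ dense_orbit_in F x U
      & forall x, @circle R x -> ~ W x -> periodic_point F x].

Definition two_periods (R : realType) (F : R -> R) : Prop :=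
  exists N1 N2 : nat,
    [/\ N1 <> N2,
        forall x, @circle R x -> minimal_period F x N1 \/ minimal_period F x N2,
        exists2 x, @circle R x & minimal_period F x N1
      & exists2 x, @circle R x & minimal_period F x N2].

(* Theta_2 = 2 pi m / n and 2 theta_2^wall < 2 pi / n on a level set of R^c(h),
   h > h^step, with walls off the axes. *)
Definition resonant_level (R : realType) (V1 V2 : R -> R)
    (q1wall q2wall h e1 : R) (m n : nat) : Prop :=
  [/\ q1wall * q2wall != 0,
      hstep V1 V2 q1wall q2wall < h /\ Rc V1 V2 q1wall q2wall h (e1, h - e1),
      (0 < m)%N /\ (0 < n)%N,
      Theta2 V1 V2 q1wall e1 (h - e1) = 2 * pi * m%:R / n%:R
    & 2 * theta2wall V2 q2wall (h - e1) < 2 * pi / n%:R].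

(* Main.v *)
Require Import Defs.
From HB Require Import structures.
From mathcomp Require Import all_boot all_order all_algebra.
From mathcomp Require Import all_classical all_reals all_analysis.
From mathcomp Require Import measurable_realfun ring lra.
Import Order.TTheory GRing.Theory Num.Theory.
Import numFieldNormedType.Exports.
Local Open Scope classical_set_scope.
Local Open Scope ring_scope.

(** Dynamics. Let L = 2 theta_2^wall and let J be the arc of length L formed by
    J_K and J_{K+1}. The exchange is the rotation by Theta_2 preceded by the
    swap of the two halves of J, and that swap is the rotation of J by the
    fraction f = {chi_2} of its length, once the two ends of J are glued. With
    Theta_2 = 2 pi m / n in lowest terms, the hypothesis L < 2 pi / n says that
    the n translates of J under the rotation are pairwise disjoint and do not
    fill the circle. A point outside the translates never sees the swap and
    has period n. A point inside them meets J exactly once every n steps, so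
    that the n-th iterate acts on each translate as the circle rotation by f
    ([exchange_arc_orbit]). Kronecker's theorem gives dense orbits when f is
    irrational; when f is a rational of denominator q, the period is n q, which
    differs from n unless f = 0. The union of the translates is invariant and
    neither null nor of full measure, whence non-ergodicity.

    Nondegeneracy. All this needs theta_2^wall > 0, that is, a positive finite
    impact time and a positive period. The integrand 1 / sqrt (2 (e - V)) is
    singular at q^max, but V' is bounded below by some c > 0 there and
    V' / sqrt (2 (e - V)) is the derivative of - sqrt (2 (e - V)), which bounds
    the integral ([slowness_integrable]). The period is positive as soon as
    there is a periodic motion at energy e ([exists_motion]). It is obtained by
    straightening the potential: with g(q) = sign(q) sqrt (2 V(q)) the energy is
    (p ^ 2 + g ^ 2) / 2, and (g, p) = r (sin phi, cos phi) solves the equations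
    of motion as soon as phi' = g'(q). The right-hand side is a positive,
    continuous and 2 pi-periodic function of phi, so that phi is the inverse of
    an ordinary primitive.

    Realizability ([resonance_realizable]). Take e_1 = e_2 = 1. As the wall
    moves in (0, q^max), the impact time varies continuously down to 0 and thus
    takes every small positive value ([impact_period_surj]). For n large, the
    first wall is placed so that the impact time of the first oscillator is
    T_2 / n, which is the resonance with m = 1. The second wall then gives
    chi_2 every large enough value: pi + K and 1 / 2 + K, K an integer, are
    respectively irrational and rational. *)

Local Notation wrap := Defs.wrap.

(** * Fractional parts and the circle *)

Section Circle.
Context {R : realType}.
Implicit Types x y u v : R.

Lemma twopi_gt0 : 0 < 2 * pi :> R.
Proof. by rewrite mulr_gt0 ?pi_gt0. Qed.

Lemma lt1_int0 (z : int) : `|z%:~R : R| < 1 -> z = 0.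
Proof.
rewrite -intr_norm -[1 : R]/(1%:~R) ltr_int => z1.
by apply/eqP; rewrite -normr_le0 -ltzD1 add0r.
Qed.

Lemma fracpart_def x (z : int) (v : R) :
  0 <= v < 1 -> x = v + z%:~R -> fracpart x = v.
Proof.
move=> v01 ->; rewrite /fracpart (@floor_def _ _ z) ?addrK//.
by rewrite intrD; move: v01; set t : R := z%:~R; lra.
Qed.

Lemma fracpart_itv x : 0 <= fracpart x < 1.
Proof.
have := floor_itv x; rewrite intrD /fracpart.
by set t : R := (Num.floor x)%:~R; lra.
Qed.

Lemma fracpartE x : x = fracpart x + (Num.floor x)%:~R.
Proof. by rewrite /fracpart subrK. Qed.

Lemma fracpartDz x (z : int) : fracpart (x + z%:~R) = fracpart x.
Proof.
apply: (@fracpart_def _ (Num.floor x + z)); first exact: fracpart_itv.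
by rewrite intrD addrA -fracpartE.
Qed.

Lemma eq_fracpart x y :
  fracpart x = fracpart y <-> exists z : int, x = y + z%:~R.
Proof.
split=> [xy|[z ->]]; last exact: fracpartDz.
exists (Num.floor x - Num.floor y).
by rewrite {1}(fracpartE x) {1}(fracpartE y) xy intrB; ring.
Qed.

Lemma wrapE x : wrap x = 2 * pi * fracpart (x / (2 * pi)).
Proof.
by rewrite /wrap /fracpart mulrBr [_ * (x / _)]mulrC divfK// gt_eqF// twopi_gt0.
Qed.

Lemma wrap_itv x : 0 <= wrap x < 2 * pi.
Proof.
have /andP[f0 f1] := fracpart_itv (x / (2 * pi)).
by rewrite wrapE mulr_ge0 ?(ltW twopi_gt0)//= gtr_pMr ?twopi_gt0.
Qed.

Lemma wrap_def x (z : int) (v : R) :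
  0 <= v < 2 * pi -> x = v + 2 * pi * z%:~R -> wrap x = v.
Proof.
move=> /andP[v0 v1] ->; have t0 := twopi_gt0.
rewrite wrapE (@fracpart_def _ z (v / (2 * pi))).
- by rewrite mulrC divfK// gt_eqF.
- by rewrite divr_ge0 ?(ltW t0)//= ltr_pdivrMr ?mul1r.
- by rewrite mulrDl [2 * pi * _]mulrC mulfK// gt_eqF.
Qed.

Lemma wrap_id x : circle x -> wrap x = x.
Proof. by move=> cx; apply: (@wrap_def _ 0) => //; rewrite mulr0 addr0. Qed.

Lemma wrapK x : exists z : int, x = wrap x + 2 * pi * z%:~R.
Proof. by exists (Num.floor (x / (2 * pi))); rewrite /wrap subrK. Qed.

Lemma eq_wrap x y :
  wrap x = wrap y <-> exists z : int, x = y + 2 * pi * z%:~R.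
Proof.
split=> [xy|[z xy]].
  have [z1 e1] := wrapK x; have [z2 e2] := wrapK y.
  by exists (z1 - z2); rewrite {1}e1 {1}e2 xy intrB; ring.
have [z2 e2] := wrapK y.
apply: (@wrap_def _ (z + z2)); first exact: wrap_itv.
by rewrite intrD mulrDr xy {1}e2; ring.
Qed.

Lemma wrapDl x y : wrap (wrap x + y) = wrap (x + y).
Proof.
have [z {2}->] := wrapK x; apply/eq_wrap; exists (- z).
by rewrite mulrNz; ring.
Qed.

Lemma wrap_from a x : circle x -> x = wrap (a + wrap (x - a)).
Proof. by move=> cx; rewrite addrC wrapDl subrK wrap_id. Qed.

End Circle.

(** * Rotations of a circle of length 1 *)

Section Rotation.
Context {R : realType}.
Implicit Types f s y e : R.

(** Dirichlet's pigeonhole: among N + 1 multiples of f two have fractional parts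
    in the same box of length 1 / N < e, and irrationality keeps them apart. *)
Lemma irrational_return f e : ~ rational f -> 0 < e ->
  exists (c : nat) (z : int), 0 < `|c%:R * f - z%:~R| < e.
Proof.
move=> irr e0; set N := (Num.truncn e^-1).+1.
have N0 : 0 < N%:R :> R by rewrite ltr0n.
have Ne : e^-1 < N%:R := truncnS_gt _.
clearbody N.
pose box (c : 'I_N.+1) : nat := Num.truncn (N%:R * fracpart (c%:R * f)).
have boxN c : (box c < N)%N.
  have /andP[v0 v1] := fracpart_itv (c%:R * f).
  rewrite truncn_lt_nat ?mulr_ge0 ?(ltW N0)//.
  by rewrite -[ltRHS]mulr1 ltr_pM2l.
have /injectivePn[c1 [c2 c12]] : ~~ injectiveb (fun c => Ordinal (boxN c)).
  by apply/negP => /injectiveP/leq_card; rewrite !card_ord ltnn.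
wlog lt12 : c1 c2 c12 / (c1 < c2)%N.
  move=> H; have [lt12|lt21|eq12] := ltngtP c1 c2.
  - exact: H.
  - by move=> e12; apply: (H c2 c1); rewrite // eq_sym.
  - by move/val_inj/eqP: eq12; rewrite (negbTE c12).
move=> /(congr1 val)/= bE.
set v1 := fracpart (c1%:R * f); set v2 := fracpart (c2%:R * f).
have v1_ge : 0 <= N%:R * v1.
  by rewrite mulr_ge0 ?(ltW N0)//; have /andP[] := fracpart_itv (c1%:R * f).
have v2_ge : 0 <= N%:R * v2.
  by rewrite mulr_ge0 ?(ltW N0)//; have /andP[] := fracpart_itv (c2%:R * f).
have /andP[l1 u1] := truncn_itv v1_ge; have /andP[l2 u2] := truncn_itv v2_ge.
rewrite -/(box c1) bE in l1 u1; rewrite -/(box c2) in l2 u2.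
exists (c2 - c1)%N, (Num.floor (c2%:R * f) - Num.floor (c1%:R * f)).
have -> : (c2 - c1)%:R * f
    - (Num.floor (c2%:R * f) - Num.floor (c1%:R * f))%:~R = v2 - v1.
  by rewrite natrB 1?ltnW// intrB /v1 /v2 /fracpart; ring.
apply/andP; split.
  rewrite normr_gt0 subr_eq0; apply/eqP => /eq_fracpart[z zE]; apply: irr.
  apply/rationalP; exists z, (c2 - c1)%N.
  have D0 : (c2 - c1)%:R != 0 :> R by rewrite pnatr_eq0 -lt0n subn_gt0.
  apply: (mulIf D0); rewrite divfK// mulrC natrB 1?ltnW//.
  by rewrite mulrBl zE addrC addKr.
have Nv : N%:R * `|v2 - v1| < 1.
  rewrite -natr1 in u1; rewrite -natr1 in u2.
  rewrite -(ger0_norm (ltW N0)) -normrM ltr_norml mulrBr; lra.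
rewrite -(ltr_pM2l N0); apply: lt_trans Nv _.
by rewrite -ltr_pdivrMr// div1r.
Qed.

(** Kronecker's theorem: a small nonzero return r of the rotation is iterated
    until it reaches the target, first shifted by an integer to the side of s
    towards which r moves. *)
Lemma irrational_rotation_dense f s y e : ~ rational f -> 0 < e ->
  exists (c : nat) (z : int), `|s + c%:R * f - y - z%:~R| < e.
Proof.
move=> irr e0; have [c [z]] := irrational_return _ _ irr e0.
set r := c%:R * f - z%:~R => /andP[]; rewrite normr_gt0 => r0 re.
(* the integer t gives the displacement y - s + t the sign of the step r *)
pose t := if 0 < r then - Num.floor (y - s) else - Num.floor (y - s) - 1.
have q0 : 0 <= (y - s + t%:~R) / r.
  have := floor_itv (y - s); rewrite intrD /t => fl.
  case: ifPn => [rp|]; first by rewrite divr_ge0 ?(ltW rp)// mulrNz; lra.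
  rewrite -leNgt => rn; rewrite -mulrNN mulr_ge0//.
    by rewrite intrB mulrNz; lra.
  by rewrite oppr_ge0 invr_le0.
have /andP[] := truncn_itv q0; set k := Num.truncn _ => k1 k2.
exists (k * c)%N, (k%:Z * z + t).
have -> : s + (k * c)%:R * f - y - (k%:Z * z + t)%:~R
    = k%:R * r - (y - s + t%:~R).
  by rewrite natrM intrD intrM /r -pmulrn; ring.
apply: le_lt_trans re; rewrite -[X in _ - X](divfK r0) -mulrBl normrM.
by rewrite -natr1 in k2; rewrite ler_piMl// ler_norml; lra.
Qed.

(** The least positive c for which c f is an integer is the denominator of f;
    Euclidean division shows that it divides all the others. *)
Lemma rational_denominator f : rational f ->
  exists2 q : nat, (0 < q)%N &
    forall c : nat, (exists z : int, c%:R * f = z%:~R) <-> (q %| c)%N.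
Proof.
move=> /rationalP[a [b fE]].
pose P c := (0 < c)%N && `[< exists z : int, c%:R * f = z%:~R >].
have exP : exists c, P c.
  have [b0|b0] := posnP b.
    exists 1%N; apply/asboolP; exists 0.
    by rewrite fE b0 invr0 !mulr0.
  exists b; rewrite /P b0; apply/asboolP; exists a.
  by rewrite fE mulrC divfK// pnatr_eq0 -lt0n.
case: (ex_minnP exP) => q /andP[q0 /asboolP[z zE]] qmin; exists q => // c.
split=> [[t tE]|/dvdnP[k ->]]; last first.
  by exists (k%:Z * z); rewrite natrM -mulrA zE intrM -pmulrn.
rewrite /dvdn -leqn0 leqNgt; apply/negP => r0.
have /qmin : P (c %% q)%N.
  rewrite /P r0; apply/asboolP; exists (t - (c %/ q)%:Z * z).
  rewrite intrB intrM -tE -zE -pmulrn {2}(divn_eq c q) natrD natrM; ring.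
by rewrite leqNgt ltn_mod q0.
Qed.

End Rotation.

(** * The exchange as a rotation over a rotation *)

Section Exchange.
Context {R : realType}.
Variables (m n : nat) (w chi : R).
Hypotheses (m_gt0 : (0 < m)%N) (n_gt0 : (0 < n)%N) (mn : coprime m n).
Hypotheses (w_gt0 : 0 < w) (w_lt : 2 * w < 2 * pi / n%:R).

Let Theta : R := 2 * pi * m%:R / n%:R.
Let F := exchange Theta w chi.
Let f : R := fracpart chi.
Let L : R := 2 * w.
Let d : R := 2 * pi / n%:R.

(** [- w - Theta / 2] is the left end of the arc J formed by J_K and J_{K+1}, so
    for u < L this is a point of the j-th translate of J. For L <= u < d it
    lies in the gap that follows this translate. *)
Let arc_pt (j : nat) (u : R) : R := wrap (- w - Theta / 2 + j%:R * Theta + u).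

Let nR0 : 0 < n%:R :> R. Proof. by rewrite ltr0n. Qed.
Let d0 : 0 < d. Proof. by rewrite divr_gt0 ?twopi_gt0. Qed.
Let nd : n%:R * d = 2 * pi. Proof. by rewrite mulrC divfK// gt_eqF. Qed.
Let ThetaE : Theta = m%:R * d. Proof. by rewrite /Theta /d; ring. Qed.
Let L0 : 0 < L. Proof. by rewrite mulr_gt0. Qed.
Let Ld : L < d. Proof. exact: w_lt. Qed.
Let f01 : 0 <= f < 1. Proof. exact: fracpart_itv. Qed.

Let jThetaE (j : nat) : exists z : int,
  j%:R * Theta = ((j * m) %% n)%:R * d + 2 * pi * z%:~R.
Proof.
exists ((j * m) %/ n)%:Z.
rewrite ThetaE mulrA -natrM {1}(divn_eq (j * m) n) natrD natrM -nd.
by rewrite -pmulrn; ring.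
Qed.

Let dvd_jm (j : nat) : (n %| j * m)%N = (n %| j)%N.
Proof. by rewrite Gauss_dvdl// coprime_sym. Qed.

Let arc_pt_circle j u : circle (arc_pt j u).
Proof. exact: wrap_itv. Qed.

Lemma arc_pt_periodic j k u : (n %| k)%N -> arc_pt (j + k) u = arc_pt j u.
Proof.
move=> /dvdnP[c ->]; apply/eq_wrap; exists (c * m)%:Z.
rewrite natrD ThetaE natrM -pmulrn natrM -nd; ring.
Qed.

(** The left ends of the translates are spaced by multiples of d, and since m
    and n are coprime only the multiples of n come back to J. *)
Let res_bound (j : nat) (u : R) : 0 <= u < d -> ~~ (n %| j)%N ->
  d <= ((j * m) %% n)%:R * d + u < 2 * pi.
Proof.
move=> /andP[u0 ud] nj; have r1 : (0 < (j * m) %% n)%N.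
  by rewrite lt0n -/(_ %| _)%N dvd_jm.
have := ltn_pmod (j * m) n_gt0; move: r1; set r := (_ %% n)%N => r1 rn.
have h1 : d <= r%:R * d by rewrite ler_peMl ?(ltW d0)// ler1n.
have h2 : r%:R * d + d <= n%:R * d.
  by rewrite -[X in _ + X]mul1r -mulrDl ler_wpM2r ?(ltW d0)// natr1 ler_nat.
rewrite nd in h2; lra.
Qed.

Let arcR j (u : R) : 0 <= u < d ->
  circle_arc (w - Theta / 2) (2 * pi - 2 * w) (arc_pt j u) =
    ~~ ((n %| j)%N && (u < L)).
Proof.
move=> u0d; rewrite /circle_arc /arc_pt wrapDl; have hLd := Ld; have hL0 := L0.
have dle : d <= 2 * pi by rewrite -nd ler_peMl ?(ltW d0)// ler1n.
have [z jE] := jThetaE j.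
have [nj|nj] := boolP (n %| j)%N => /=.
  have /eqP r0 : ((j * m) %% n == 0)%N by rewrite -/(_ %| _)%N dvd_jm.
  move: jE; rewrite r0.
  rewrite mul0r add0r => jE.
  have [uL|uL] := ltP u L.
    rewrite (@wrap_def _ _ (z - 1) (u - L + 2 * pi)).
    - by apply/negbTE; rewrite -leNgt /L; lra.
    - by lra.
    - by rewrite jE intrB /L; ring.
  rewrite (@wrap_def _ _ z (u - L)).
  - by apply: (introT idP); rewrite /L; lra.
  - by lra.
  - by rewrite jE /L; ring.
have := res_bound _ _ u0d nj; set r := (_ %% n)%N%:R * d => rb.
rewrite (@wrap_def _ _ z (r + u - L)).
- by apply: (introT idP); rewrite /L; lra.
- by lra.
- by rewrite jE -/r /L; ring.
Qed.

Let arcK j (u : R) : 0 <= u < d -> (n %| j)%N ->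
  circle_arc (w - Theta / 2 + (2 * pi - 2 * w)) (L * (1 - f)) (arc_pt j u) =
    (u < L * (1 - f)).
Proof.
move=> u0d nj; rewrite /circle_arc /arc_pt wrapDl.
have dle : d <= 2 * pi by rewrite -nd ler_peMl ?(ltW d0)// ler1n.
have [z jE] := jThetaE j; move: jE.
have /eqP -> : ((j * m) %% n == 0)%N by rewrite -/(_ %| _)%N dvd_jm.
rewrite mul0r add0r => jE.
rewrite (@wrap_def _ _ (z - 1) u)//; first by lra.
by rewrite jE intrB; ring.
Qed.

Lemma exchange_outside j (u : R) : L <= u < d -> F (arc_pt j u) = arc_pt j.+1 u.
Proof.
have hL0 := L0; move=> uLd; rewrite /F /exchange arcR; last by lra.
have /negbTE -> : ~~ (u < L) by rewrite -leNgt; lra.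
rewrite andbF /=.
by rewrite wrapDl /arc_pt; congr wrap; rewrite -natr1; ring.
Qed.

(** At the times j divisible by n the translate is J itself, and only then the
    swap acts, as a rotation by f in the coordinate t of J. *)
Lemma exchange_inside j (t : R) : 0 <= t < 1 ->
  F (arc_pt j (L * t)) = arc_pt j.+1 (L * if (n %| j)%N then fracpart (t + f) else t).
Proof.
have hLd := Ld; have hf01 := f01.
move=> t01; have tL : 0 <= L * t < d.
  have : L * t < L by rewrite gtr_pMr//; lra.
  by rewrite mulr_ge0 ?(ltW L0)//=; lra.
have tL' : L * t < L by rewrite gtr_pMr//; lra.
rewrite /F /exchange arcR// tL' andbT.
case: ifPn => [/negbTE ->|].
  by rewrite wrapDl /arc_pt; congr wrap; rewrite -natr1; ring.
rewrite negbK => nj; rewrite nj -/f -/L arcK// ltr_pM2l//.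
case: ifPn => [tf|tf].
  have -> : fracpart (t + f) = t + f.
    by apply: (@fracpart_def _ _ 0); [lra | rewrite addr0].
  rewrite /arc_pt -[wrap _ + _ + _]addrA wrapDl; congr wrap.
  by rewrite -natr1; ring.
rewrite -leNgt in tf.
have -> : fracpart (t + f) = t + f - 1.
  by apply: (@fracpart_def _ _ 1); [lra | rewrite subrK].
rewrite /arc_pt -[wrap _ + _ + _]addrA wrapDl; congr wrap.
by rewrite -natr1; ring.
Qed.

(** The number of i < j divisible by n, that is, of the times before j at which
    a point that starts in J is rotated inside J. *)
Let passages (j : nat) : nat := ((j + n.-1) %/ n)%N.

Let passagesS j : passages j.+1 = ((n %| j) + passages j)%N.
Proof.
by rewrite /passages addSn divnS// -addnS prednK// dvdn_addl.
Qed.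

Let passagesDM j k : passages (j + n * k) = (passages j + k)%N.
Proof. by rewrite /passages addnAC addnC mulnC divnMDl// addnC. Qed.

(** The phase f is added once per passage, which makes the whole orbit an
    explicit function of the time j and of one real parameter s. *)
Let arc_orbit (s : R) (j : nat) : R :=
  arc_pt j (L * fracpart (s + (passages j)%:R * f)).

Lemma exchange_arc_orbit s j : F (arc_orbit s j) = arc_orbit s j.+1.
Proof.
rewrite /arc_orbit exchange_inside ?fracpart_itv// passagesS.
case: (n %| j)%N; rewrite ?add0n//; congr (arc_pt _ (L * _)).
apply/eq_fracpart; exists (- Num.floor (s + (passages j)%:R * f)).
by rewrite {1}/fracpart natrD mulrNz /=; ring.
Qed.

Lemma iter_arc_orbit s j k : iter k F (arc_orbit s j) = arc_orbit s (j + k).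
Proof.
by elim: k => [|k IH]; rewrite ?addn0//= IH exchange_arc_orbit addnS.
Qed.

Lemma iter_outside j k (u : R) :
  L <= u < d -> iter k F (arc_pt j u) = arc_pt (j + k) u.
Proof.
move=> Lud; elim: k => [|k IH]; rewrite ?addn0//= IH exchange_outside//.
by rewrite addnS.
Qed.

(** The translates, each with the gap after it, tile the circle. The rotation
    visits them in an order given by an inverse of m modulo n, hence Bezout. *)
Lemma arc_pt_cover x : circle x ->
  exists (j : nat) (u : R), [/\ (j < n)%N, 0 <= u < d & x = arc_pt j u].
Proof.
move=> cx; set a := - w - Theta / 2.
have /andP[v0 v1] := wrap_itv (x - a); have xE := wrap_from a _ cx.
move: v0 v1 xE; set v := wrap _ => v0 v1 xE.
have q0 : 0 <= v / d by rewrite divr_ge0// ltW.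
have /andP[] := truncn_itv q0; set i := Num.truncn _ => iv vi.
have i_n : (i < n)%N.
  rewrite -(ltr_nat R); apply: le_lt_trans iv _.
  by rewrite ltr_pdivrMr// nd.
have [km kn kE _] := egcdnP n m_gt0.
exists ((km * i) %% n)%N, (v - i%:R * d); split.
- by rewrite ltn_mod.
- rewrite ler_pdivlMr// in iv; rewrite ltr_pdivrMr// in vi.
  rewrite -natr1 mulrDl mul1r in vi.
  lra.
- have [z zE] := jThetaE ((km * i) %% n).
  rewrite {1}xE; apply/eq_wrap; exists (- z).
  rewrite zE modnMml mulnAC kE (eqP mn) mulnDl mul1n mulnAC modnMDl.
  by rewrite modn_small// mulrNz /a; ring.
Qed.

Lemma arc_pt_inj j k (u v : R) :
  0 <= u < d -> 0 <= v < d -> arc_pt j u = arc_pt k v ->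
  u = v /\ j = k %[mod n].
Proof.
move=> ud vd; have [z zE] := jThetaE j; have [t tE] := jThetaE k.
have rn i : (((i * m) %% n)%:R + 1) * d <= 2 * pi.
  by rewrite -nd ler_wpM2r ?(ltW d0)// natr1 ler_nat ltn_mod.
move=> /eq_wrap[y]; rewrite zE tE.
set r := ((j * m) %% n)%N; set r' := ((k * m) %% n)%N => yE.
have rE : r%:R * d + u = r'%:R * d + v.
  have rr := rn j; have rr' := rn k; rewrite -/r -/r' in rr rr'.
  have p0 : 0 <= r%:R * d by rewrite mulr_ge0 ?(ltW d0).
  have p0' : 0 <= r'%:R * d by rewrite mulr_ge0 ?(ltW d0).
  rewrite -(@wrap_def _ (r%:R * d + u) 0 (r%:R * d + u)); last first.
  - by rewrite mulr0 addr0.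
  - lra.
  apply: (@wrap_def _ _ (y + t - z)); first lra.
  by rewrite intrB intrD; move: yE; lra.
have rr : r = r'.
  have [rr'|rr'|//] := ltngtP r r'.
    have h : (r%:R + 1) * d <= r'%:R * d.
      by rewrite ler_wpM2r ?(ltW d0)// natr1 ler_nat.
    by exfalso; lra.
  have h : (r'%:R + 1) * d <= r%:R * d.
    by rewrite ler_wpM2r ?(ltW d0)// natr1 ler_nat.
  by exfalso; lra.
split; first by move: rE; rewrite rr => /addrI.
move: rr; rewrite /r /r' => /eqP.
wlog kj : j k {zE tE yE rE r r'} / (k <= j)%N.
  move=> H; have [/H//|/ltnW kj] := leqP k j; rewrite eq_sym => e.
  exact/esym/(H _ _ kj).
rewrite eqn_mod_dvd ?leq_mul2r ?kj ?orbT// -mulnBl dvd_jm => kj'.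
by apply/eqP; rewrite eqn_mod_dvd.
Qed.

Definition exchanged_arcs : set R :=
  [set x | circle x /\
    exists2 i : nat, (i < n)%N & circle_arc (- w - Theta / 2 + i%:R * Theta) L x].

Lemma arc_pt_arcs j (u : R) : 0 <= u < d -> exchanged_arcs (arc_pt j u) <-> u < L.
Proof.
have hLd := Ld.
have dle : d <= 2 * pi by rewrite -nd ler_peMl ?(ltW d0)// ler1n.
move=> ud; split=> [[_ [i _]]|uL].
  rewrite /circle_arc; set v := wrap _ => vL.
  have /andP[v0 _] := wrap_itv (arc_pt j u - (- w - Theta / 2 + i%:R * Theta)).
  rewrite -/v in v0.
  have : arc_pt j u = arc_pt i v by apply: wrap_from.
  by move=> /arc_pt_inj[]//; [lra|move=> ->].
split; first exact: arc_pt_circle.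
exists (j %% n)%N; rewrite ?ltn_pmod// /circle_arc.
rewrite {1}(divn_eq j n) addnC arc_pt_periodic ?dvdn_mull// /arc_pt wrapDl.
by rewrite (@wrap_def _ _ 0 u) ?mulr0 ?addr0//; [lra|ring].
Qed.

Lemma arc_pt_period j k (u : R) : L <= u < d ->
  (iter k F (arc_pt j u) = arc_pt j u) <-> (n %| k)%N.
Proof.
have hL0 := L0; move=> Lud; rewrite iter_outside//.
split; last exact: arc_pt_periodic.
move=> /arc_pt_inj[||_ /eqP]; [lra|lra|].
by rewrite eqn_mod_dvd ?leq_addr// addKn.
Qed.

Let frac_arc (t : R) : 0 <= L * fracpart t < L.
Proof.
have /andP[? ?] := fracpart_itv t.
by rewrite mulr_ge0 ?(ltW L0)//= gtr_pMr.
Qed.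

Let frac_gap (t : R) : 0 <= L * fracpart t < d.
Proof. have hLd := Ld; have := frac_arc t; lra. Qed.

Lemma arc_orbit_arcs s j : exchanged_arcs (arc_orbit s j).
Proof.
by apply/arc_pt_arcs => //; have /andP[] := frac_arc (s + (passages j)%:R * f).
Qed.

Lemma arc_orbit_cover x : exchanged_arcs x -> exists s j, x = arc_orbit s j.
Proof.
move=> Wx; have [j [u [jn ud xE]]] := arc_pt_cover x Wx.1.
have /arc_pt_arcs uL : exchanged_arcs (arc_pt j u) by rewrite -xE.
exists (u / L - (passages j)%:R * f), j; rewrite xE /arc_orbit subrK.
rewrite (@fracpart_def _ _ 0 (u / L)) ?addr0//; last first.
  have /andP[u0 _] := ud.
  by rewrite divr_ge0 ?(ltW L0)//= ltr_pdivrMr ?mul1r// uL.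
by rewrite mulrC divfK// gt_eqF.
Qed.

Lemma arc_orbit_period s j k : (iter k F (arc_orbit s j) = arc_orbit s j) <->
  exists2 c : nat, k = (n * c)%N & exists z : int, c%:R * f = z%:~R.
Proof.
rewrite iter_arc_orbit; split=> [/arc_pt_inj[//|//|uE /eqP]|[c -> [z cz]]].
  rewrite eqn_mod_dvd ?leq_addr// addKn => /dvdnP[c kE].
  exists c; first by rewrite mulnC.
  move: uE => /(mulfI (lt0r_neq0 L0))/eq_fracpart[z].
  rewrite kE mulnC passagesDM natrD => zE; exists z; lra.
rewrite /arc_orbit arc_pt_periodic ?dvdn_mulr// passagesDM; congr (arc_pt _ (L * _)).
by apply/eq_fracpart; exists z; rewrite natrD -cz; ring.
Qed.

Lemma exchanged_arcs_exchange x : circle x ->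
  exchanged_arcs (F x) <-> exchanged_arcs x.
Proof.
have hL0 := L0; move=> cx; have [j [u [jn ud xE]]] := arc_pt_cover x cx.
have [uL|uL] := ltP u L.
  have Wx : exchanged_arcs x by rewrite xE; apply/arc_pt_arcs.
  split=> // _; have [s [i ->]] := arc_orbit_cover _ Wx.
  by rewrite exchange_arc_orbit; exact: arc_orbit_arcs.
rewrite xE exchange_outside; last lra.
by split=> /arc_pt_arcs -/(_ ud) uL'; exfalso; lra.
Qed.

Lemma circleE : @circle R = `[0, 2 * pi[%classic :> set R.
Proof. by apply/seteqP; split=> x /=; rewrite in_itv. Qed.

Lemma measurable_arcs : measurable (exchanged_arcs : set (measurableTypeR R)).
Proof.
have -> : exchanged_arcs = @circle R `&` \bigcup_(i in [set i | (i < n)%N])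
    \bigcup_(z : int)
    `[- w - Theta / 2 + i%:R * Theta + 2 * pi * z%:~R,
      - w - Theta / 2 + i%:R * Theta + 2 * pi * z%:~R + L[%classic.
  apply/seteqP; split=> x.
    move=> [cx [i i_n]]; rewrite /circle_arc => xL; split => //; exists i => //.
    have [z zE] := wrapK (x - (- w - Theta / 2 + i%:R * Theta)).
    exists z => //=; rewrite in_itv /=.
    have /andP[] := wrap_itv (x - (- w - Theta / 2 + i%:R * Theta)); lra.
  move=> [cx [i i_n [z _ /=]]]; rewrite in_itv/= => xz; split=> //.
  exists i => //; have hLd := Ld.
  have dle : d <= 2 * pi by rewrite -nd ler_peMl ?(ltW d0)// ler1n.
  rewrite /circle_arc (@wrap_def _ _ z
    (x - (- w - Theta / 2 + i%:R * Theta) - 2 * pi * z%:~R)); [lra|lra|ring].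
apply: measurableI; first by rewrite circleE; exact: measurable_itv.
apply: bigcup_measurable => i _; apply: countable_bigcupT_measurable => //.
Qed.

(** An arc of the circle need not be an interval of [0, 2 pi[, but the part of
    it before 2 pi is one, and it has positive length. *)
Let arc_pt_measure_neq0 (A : set (measurableTypeR R)) (u1 u2 : R) :
  measurable A -> u1 < u2 -> (forall u, u1 <= u < u2 -> A (arc_pt 0 u)) ->
  lebesgue_measure A <> 0%E.
Proof.
move=> mA u12 uA.
have /andP[x0 x1] : 0 <= arc_pt 0 u1 < 2 * pi := arc_pt_circle 0 u1.
pose e : R := Num.min (u2 - u1) (2 * pi - arc_pt 0 u1).
have e0 : 0 < e by rewrite lt_min !subr_gt0 u12.
pose I : set R := `[arc_pt 0 u1, arc_pt 0 u1 + e[%classic.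
have sub : I `<=` A.
  move=> y; rewrite /I /= in_itv/= => /andP[y0 y1].
  have ye : y - arc_pt 0 u1 < e by lra.
  move: ye; rewrite lt_min => /andP[ye1 ye2].
  have -> : y = arc_pt 0 (u1 + (y - arc_pt 0 u1)); last by apply: uA; lra.
  rewrite /arc_pt [X in wrap X]addrA -wrapDl -/(arc_pt 0 u1) addrC subrK.
  by rewrite wrap_id//; apply/andP; split; lra.
apply/eqP; rewrite gt_eqF//.
have : (lebesgue_measure I <= lebesgue_measure A)%E.
  by apply: le_measure; rewrite ?inE//; exact: measurable_itv.
apply: lt_le_trans; rewrite /I lebesgue_measure_itv/= lte_fin ltrDl e0.
by rewrite -EFinB lte_fin; lra.
Qed.

Lemma exchange_not_ergodic : ~ ergodic F.
Proof.
have hLd := Ld; have hL0 := L0; move=> /(_ exchanged_arcs measurable_arcs)[].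
- by move=> x [].
- apply/seteqP; split=> x; first by move=> [cx /exchanged_arcs_exchange]; apply.
  by move=> Wx; have cx := Wx.1; split=> //; apply/exchanged_arcs_exchange.
- apply: (arc_pt_measure_neq0 _ _ _ measurable_arcs L0) => u uL.
  apply/arc_pt_arcs; lra.
- apply: (@arc_pt_measure_neq0 _ L d _ Ld).
    apply: measurableD; last exact: measurable_arcs.
    by rewrite circleE; exact: measurable_itv.
  move=> u ud; split; first exact: arc_pt_circle.
  by move=> /arc_pt_arcs uL; have : u < L; [apply: uL|]; lra.
Qed.

Lemma exchange_dense : ~ rational f -> dense_on_arcs_periodic_off F.
Proof.
have hLd := Ld; have hL0 := L0.
move=> irr; exists n.-1, (fun i => - w - Theta / 2 + i%:R * Theta), (fun=> L).
have WE : [set x | circle x /\ exists i : 'I_n.-1.+1,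
    circle_arc (- w - Theta / 2 + i%:R * Theta) L x] = exchanged_arcs.
  apply/seteqP; split=> x [cx].
    by move=> [[i i_n] xi]; split=> //; exists i; rewrite // -(prednK n_gt0).
  move=> [i i_n xi]; split => //; rewrite -(prednK n_gt0) in i_n.
  by exists (Ordinal i_n).
rewrite WE; split.
- move=> _; rewrite hL0 (lt_le_trans hLd)//.
  by rewrite -nd ler_peMl ?(ltW d0)// ler1n.
- move=> x /arc_orbit_cover[s [j ->]]; split.
    by move=> k; rewrite iter_arc_orbit; exact: arc_orbit_arcs.
  move=> y [cy [i]]; rewrite /open_circle_arc.
  set a := (X in y - X) => yL e e0; have yE := wrap_from a y cy.
  move: yL yE; set v := wrap _ => /andP[v0 vL] yE.
  set t := v / L.
  have t0 : 0 < t by rewrite divr_gt0.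
  have t1 : t < 1 by rewrite ltr_pdivrMr ?mul1r.
  have tE : L * t = v by rewrite mulrC divfK// gt_eqF.
  (* within t and 1 - t of the target the phase has no integer to cross *)
  pose e' := Num.min (e / L) (Num.min t (1 - t)).
  have e'0 : 0 < e' by rewrite !lt_min divr_gt0// t0 subr_gt0.
  have [c [z]] := irrational_rotation_dense f
    (s + (passages i + j)%:R * f) t e' irr e'0.
  rewrite !lt_min => /andP[ce /andP[ct0 ct1]].
  (* the time is congruent to i - j modulo n, and every n steps rotate by f *)
  exists (i + n.-1 * j + n * c)%N.
  have -> : iter (i + n.-1 * j + n * c) F (arc_orbit s j) =
      arc_pt i (L * fracpart (s + (passages i + j)%:R * f + c%:R * f)).
    have kE (k : nat) : (j + (k + n.-1 * j + n * c) = k + n * (j + c))%N.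
      have nj : (n * j = j + n.-1 * j)%N by rewrite -mulSn prednK.
      by rewrite mulnDr nj !addnA (addnC j).
    rewrite iter_arc_orbit kE /arc_orbit arc_pt_periodic ?dvdn_mulr// passagesDM.
    by congr (arc_pt _ (L * fracpart _)); rewrite !natrD; ring.
  move: ce ct0 ct1; set r := _ + c%:R * f => ce ct0 ct1.
  have -> : fracpart r = r - z%:~R.
    apply: (@fracpart_def _ _ z); last by rewrite subrK.
    by move: ct0 ct1; rewrite !ltr_norml; lra.
  have [z1 z1E] := wrapK (a + L * (r - z%:~R)).
  have [z2 z2E] := wrapK (a + v).
  exists (z2 - z1); rewrite -/(wrap _) -/a yE intrB.
  have -> : arc_pt i (L * (r - z%:~R)) - wrap (a + v)
      - 2 * pi * (z2%:~R - z1%:~R) = L * (r - t - z%:~R).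
    have -> : arc_pt i (L * (r - z%:~R)) =
        a + L * (r - z%:~R) - 2 * pi * z1%:~R by rewrite {1}z1E addrK.
    have -> : wrap (a + v) = a + v - 2 * pi * z2%:~R by rewrite {2}z2E addrK.
    by rewrite -tE; ring.
  by rewrite normrM (gtr0_norm L0) mulrC -ltr_pdivlMr.
- move=> x cx Wx; have [j [u [jn ud xE]]] := arc_pt_cover x cx.
  exists n => //; rewrite xE; apply/arc_pt_period => //.
  have := arc_pt_arcs j u ud; rewrite -xE => WL.
  have : ~~ (u < L) by apply/negP => /WL.
  rewrite -leNgt; lra.
Qed.

Let minimal_periodP x N : (0 < N)%N ->
  (forall k, (iter k F x = x) <-> (N %| k)%N) -> minimal_period F x N.
Proof.
move=> N0 xN; split=> //; first exact/xN.
by move=> k /andP[k0 kN] /xN /(dvdn_leq k0); rewrite leqNgt kN.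
Qed.

Let exchange_periods : rational f -> exists q,
  [/\ (0 < q)%N, (f != 0 -> q != 1%N),
    forall x, exchanged_arcs x -> minimal_period F x (n * q) &
    forall x, circle x -> ~ exchanged_arcs x -> minimal_period F x n].
Proof.
have hf01 := f01.
move=> /rational_denominator[q q0 qP]; exists q; split=> //.
- move=> f0; apply: contra_neq f0 => q1.
  have [z] : exists z : int, 1%:R * f = z%:~R.
    by apply/qP; rewrite q1.
  rewrite mul1r => fz; have z0 : z = 0.
    by apply: (@lt1_int0 R); rewrite -fz ger0_norm; lra.
  by rewrite fz z0.
- move=> y /arc_orbit_cover[s [j ->]].
  apply: minimal_periodP => [|k]; first by rewrite muln_gt0 n_gt0.
  split=> [/arc_orbit_period[c -> /qP]|/dvdnP[c ->]]; first by rewrite dvdn_pmul2l.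
  apply/arc_orbit_period; exists (q * c)%N; first by rewrite mulnC mulnA.
  by apply/qP; rewrite dvdn_mulr.
- move=> y cy Wy; have [j [u [jn ud yE]]] := arc_pt_cover y cy.
  rewrite yE; apply: minimal_periodP => // k; apply: arc_pt_period.
  have := arc_pt_arcs j u ud; rewrite -yE => WL.
  have : ~~ (u < L) by apply/negP => /WL.
  by rewrite -leNgt; lra.
Qed.

Lemma exchange_periodic :
  rational f -> forall x, circle x -> periodic_point F x.
Proof.
move=> ratf x cx; have [q [q0 _ inP outP]] := exchange_periods ratf.
have [/inP[]|/(outP _ cx)[]] := pselect (exchanged_arcs x).
  by exists (n * q)%N.
by exists n.
Qed.

Lemma exchange_two_periods : rational f -> f != 0 -> two_periods F.
Proof.
have hLd := Ld; have hL0 := L0; have hd0 := d0.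
move=> ratf f0; have [q [q0 /(_ f0) q1 inP outP]] := exchange_periods ratf.
exists n, (n * q)%N; split.
- apply/eqP; apply: contra_neq q1; rewrite -{1}[n]muln1 => /eqP.
  by rewrite eqn_pmul2l// => /eqP.
- move=> x cx.
  by have [/inP|/(outP _ cx)] := pselect (exchanged_arcs x); [right|left].
- exists (arc_pt 0 L); first exact: arc_pt_circle.
  apply: outP; first exact: arc_pt_circle.
  by rewrite arc_pt_arcs ?ltxx//; lra.
- exists (arc_pt 0 0); first exact: arc_pt_circle.
  apply: inP; apply/arc_pt_arcs => //; lra.
Qed.

End Exchange.

(** * Shape of the potential *)

Section Potential.
Context {R : realType}.
Variable V : R -> R.
Hypothesis hV : admissible_potential V.

Lemma is_derive_potential q : is_derive q (1 : R) V (derive1 V q).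
Proof.
have [dV _ _ _ _] := hV.
by rewrite derive1E; apply/derivableP; exact: (dV 0%N).
Qed.

Lemma continuous_potential : continuous V.
Proof.
move=> q; apply/differentiable_continuous/derivable1_diffP.
by have [dV _ _ _ _] := hV; exact: (dV 0%N).
Qed.

Lemma continuous_force : continuous (derive1 V).
Proof.
move=> q; apply/differentiable_continuous/derivable1_diffP.
by have [dV _ _ _ _] := hV; exact: (dV 1%N).
Qed.

Lemma force_gt0 q : 0 < q -> 0 < derive1 V q.
Proof.
have [_ _ sV _ _] := hV; move=> q0.
by have := sV q (lt0r_neq0 q0); rewrite pmulr_rgt0.
Qed.

Lemma force_lt0 q : q < 0 -> derive1 V q < 0.
Proof.
have [_ _ sV _ _] := hV; move=> q0.
by have := sV q (ltr0_neq0 q0); rewrite nmulr_rgt0.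
Qed.

Lemma potential0 : V 0 = 0. Proof. by have [_ []] := hV. Qed.

Lemma potential_incr x y : 0 <= x -> x < y -> V x < V y.
Proof.
move=> x0 xy.
have [|c] := @MVT _ V (derive1 V) x y xy _
  (continuous_subspaceT continuous_potential).
  by move=> ? _; exact: is_derive_potential.
rewrite in_itv/= => /andP[xc _] VE; rewrite -subr_gt0 VE mulr_gt0 ?subr_gt0//.
by apply: force_gt0; lra.
Qed.

Lemma potential_decr x y : y <= 0 -> x < y -> V y < V x.
Proof.
move=> y0 xy.
have [|c] := @MVT _ V (derive1 V) x y xy _
  (continuous_subspaceT continuous_potential).
  by move=> ? _; exact: is_derive_potential.
rewrite in_itv/= => /andP[_ cy] VE; rewrite -subr_lt0 VE nmulr_rlt0 ?subr_gt0//.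
by apply: force_lt0; lra.
Qed.

Lemma potential_gt0 q : q != 0 -> 0 < V q.
Proof.
rewrite neq_lt => /orP[q0|q0].
  by have := potential_decr q 0 (lexx 0) q0; rewrite potential0.
by have := potential_incr 0 q (lexx 0) q0; rewrite potential0.
Qed.

Lemma potential_ge0 q : 0 <= V q.
Proof. by have [->|/potential_gt0/ltW//] := eqVneq q 0; rewrite potential0. Qed.

Lemma qmaxP e : 0 < e -> 0 < qmax V e /\ V (qmax V e) = e.
Proof.
have [_ _ _ Vy _] := hV; move=> e0.
have [b [b0 Vb]] : exists b, 0 < b /\ e <= V b.
  move/cvgryPge : Vy => /(_ e)[M [Mr MV]].
  exists (Num.max (M + 1) 1); rewrite lt_max ltr01 orbT; split=> //.
  by apply: MV; rewrite lt_max ltrDl ltr01.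
have [|q qb Vq] := @IVT _ V 0 b e (ltW b0)
  (continuous_subspaceT continuous_potential).
  rewrite potential0 min_l ?potential_ge0// max_r ?potential_ge0//.
  by rewrite (ltW e0).
rewrite /qmax; case: xgetP => [x -> [] //|/(_ q)[]]; split=> //.
rewrite lt_neqAle; move: qb; rewrite in_itv/= => /andP[-> _]; rewrite andbT.
apply/eqP => q0; move: Vq; rewrite -q0 potential0 => e00.
by rewrite -e00 ltxx in e0.
Qed.

(** * The impact time *)

Section Impact.
Variables (e a : R).
Hypothesis (Va : V a < e) (a_lt : a < qmax V e).

Let e0 : 0 < e. Proof. exact: le_lt_trans (potential_ge0 _) Va. Qed.
Let b := qmax V e.
Let b0 : 0 < b. Proof. by have [] := qmaxP _ e0. Qed.
Let Vb : V b = e. Proof. by have [] := qmaxP _ e0. Qed.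

Let slowness q := (Num.sqrt (2 * (e - V q)))^-1.

Let V_lt q : a <= q < b -> V q < e.
Proof.
move=> /andP[aq qb]; have [q0|q0] := leP 0 q.
  by rewrite -Vb potential_incr.
apply: le_lt_trans Va; move: aq; rewrite le_eqVlt => /predU1P[->//|aq].
by apply/ltW/potential_decr => //; exact: ltW.
Qed.

Let h_gt0 q : a <= q < b -> 0 < 2 * (e - V q).
Proof. by move=> /V_lt Vq; rewrite mulr_gt0// subr_gt0. Qed.

Let speed_gt0 q : a <= q < b -> 0 < Num.sqrt (2 * (e - V q)).
Proof. by move=> /h_gt0; rewrite sqrtr_gt0. Qed.

Let slowness_ge0 q : 0 <= slowness q.
Proof. by rewrite invr_ge0 sqrtr_ge0. Qed.

Let continuous_speed : continuous (fun q => Num.sqrt (2 * (e - V q))).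
Proof.
move=> q; apply: (@continuous_comp _ _ _ (fun q => 2 * (e - V q)) Num.sqrt);
  last exact: sqrt_continuous.
by apply: cvgMr; apply: cvgB; [exact: cvg_cst|exact: continuous_potential].
Qed.

Let continuous_slowness q : a <= q < b -> {for q, continuous slowness}.
Proof.
move=> /speed_gt0 s0; apply: cvgV; first exact: lt0r_neq0.
exact: continuous_speed.
Qed.

Let measurable_slowness :
  measurable_fun `[a, b] (slowness : measurableTypeR R -> R).
Proof.
apply/measurable_fun_itv_bndo_bndcP/measurable_fun_itv_obnd_cbndP.
apply: open_continuous_measurable_fun => // q.
rewrite inE/= in_itv/= => /andP[aq qb].
by apply: continuous_slowness; rewrite (ltW aq).
Qed.

Let is_derive_speed q : a <= q < b ->
  is_derive q (1 : R) (fun q => Num.sqrt (2 * (e - V q)))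
    (- (derive1 V q * slowness q)).
Proof.
move=> qb; have dV := is_derive_potential q.
have dh : is_derive q (1 : R) (fun q => 2 * (e - V q)) (- (2 * derive1 V q)).
  by apply: is_derive_eq; rewrite /GRing.scale/=; ring.
have ds := @is_derive1_comp R Num.sqrt (fun q => 2 * (e - V q)) q _ _
  (is_derive1_sqrt (h_gt0 _ qb)) dh.
apply: (is_derive_eq ds).
have s0 := lt0r_neq0 (speed_gt0 _ qb).
by rewrite /slowness; field; rewrite s0.
Qed.

Local Notation mu := (@lebesgue_measure R).

(** Where V' >= m the slowness is at most V' * slowness / m, whose primitive is
    minus the speed over m. The fundamental theorem of calculus applies away
    from the singular end b, and monotone convergence does the rest. *)
Let integral_slowness_le (x m : R) : 0 < m -> a <= x -> x < b ->
  (forall q, x <= q <= b -> m <= derive1 V q) ->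
  (\int[mu]_(q in `[x, b[) (slowness q)%:E <=
    (m^-1 * Num.sqrt (2 * (e - V x)))%:E)%E.
Proof.
move=> m0 ax xb Vm.
pose y n := b - (b - x) / n.+2%:R.
have yx n : x < y n < b.
  have d0 : 0 < (b - x) / n.+2%:R by rewrite divr_gt0 ?subr_gt0.
  have d1 : (b - x) / n.+2%:R < b - x.
    by rewrite ltr_pdivrMr// ltr_pMr ?subr_gt0// ltr1n.
  by rewrite /y; move: d0 d1; set t := _ / n.+2%:R => d0 d1; lra.
have ynd : {homo y : i j / (i <= j)%N >-> i <= j}.
  move=> i j ij; rewrite /y lerD2l lerN2 ler_pM2l ?subr_gt0//.
  by rewrite lef_pV2 ?posrE// ler_nat.
have partial n : (\int[mu]_(q in `[x, y n]) (slowness q)%:E <=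
    (m^-1 * Num.sqrt (2 * (e - V x)))%:E)%E.
  have /andP[xy yb] := yx n.
  have itvP q : q \in `[x, y n] -> a <= q < b.
    by rewrite in_itv/= => /andP[? ?]; lra.
  pose g q := m^-1 * (derive1 V q * slowness q).
  have cg : {within `[x, y n], continuous g}.
    apply: continuous_in_subspaceT => q; rewrite inE/= => /itvP qb.
    apply: cvgMr; apply: cvgM; first exact: continuous_force.
    exact: continuous_slowness.
  have dG q : q \in `[x, y n] -> is_derive q (1 : R)
      (fun q => - m^-1 * Num.sqrt (2 * (e - V q))) (g q).
    move=> /itvP qb; have ds := is_derive_speed _ qb.
    by apply: is_derive_eq; rewrite /g /GRing.scale/=; ring.
  apply: (@le_trans _ _ (\int[mu]_(q in `[x, y n]) (g q)%:E)%E).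
    apply: ge0_le_integral => //.
    - by move=> q _; rewrite lee_fin.
    - apply/measurable_EFinP; apply: measurable_funS measurable_slowness => //.
      by move=> q /itvP; rewrite /= in_itv/=; lra.
    - apply/measurable_EFinP.
      exact: (subspace_continuous_measurable_fun _ cg).
    - move=> q; rewrite /= => qxy; rewrite lee_fin /g mulrA ler_peMl//.
      rewrite mulrC ler_pdivlMr// mul1r; apply: Vm.
      by move: qxy; rewrite in_itv/=; lra.
  rewrite (@continuous_FTC2 _ g (fun q => - m^-1 * Num.sqrt (2 * (e - V q))))//.
  - rewrite -EFinB lee_fin !mulNr opprK gerDr oppr_le0.
    by rewrite mulr_ge0 ?sqrtr_ge0// invr_ge0 ltW.
  - split.
    + by move=> q /subset_itv_oo_cc /dG[].
    + apply: cvg_at_right_filter; apply: cvgMr; exact: continuous_speed.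
    + apply: cvg_at_left_filter; apply: cvgMr; exact: continuous_speed.
  - move=> q qxy; rewrite derive1E; have dGq := dG q (subset_itv_oo_cc qxy).
    by rewrite derive_val.
have -> : `[x, b[%classic = \bigcup_n `[x, y n]%classic.
  apply/seteqP; split=> q /=.
    rewrite in_itv/= => /andP[xq qb].
    exists (Num.truncn ((b - x) / (b - q))) => //=; rewrite in_itv/= xq /=.
    have := truncnS_gt ((b - x) / (b - q)); set N := Num.truncn _ => NP.
    rewrite ltr_pdivrMr ?subr_gt0// in NP.
    rewrite /y lerBrDr -lerBrDl ler_pdivrMr// -natr1 mulrDr.
    rewrite mulrC in NP; apply: ltW; apply: lt_le_trans NP _.
    by rewrite lerDl; lra.
  move=> [n _ /=]; rewrite !in_itv/=; have := yx n; lra.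
have cv : (\int[mu]_(q in `[x, y n]) (slowness q)%:E)%E @[n --> \oo] -->
    (\int[mu]_(q in \bigcup_n `[x, y n]%classic) (slowness q)%:E)%E.
  apply: ge0_nondecreasing_set_cvg_integral => //.
  - move=> i j ij; apply/subsetPset => q; rewrite /= !in_itv/= => /andP[-> qi].
    exact: le_trans qi (ynd _ _ ij).
  - move=> n; apply/measurable_EFinP.
    apply: measurable_funS measurable_slowness => //.
    by move=> q; rewrite /= !in_itv/=; have := yx n; lra.
  - by move=> n q _; rewrite lee_fin.
apply: (cvge_le _ cv); exact: nearW.
Qed.

(** The turning point b is positive, so V' is bounded below by a positive
    constant on a segment [x, b]; on [a, x] the slowness is continuous. *)
Lemma slowness_integrable : mu.-integrable `[a, b] (EFin \o slowness).
Proof.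
pose x := Num.max a (b / 2).
have ax : a <= x by rewrite le_max lexx.
have x0 : 0 < x by rewrite lt_max divr_gt0 ?orbT.
have xb : x < b by rewrite gt_max a_lt gtr_pMr// invf_lt1// ltr1n.
have [c cb Vc] := EVT_min (ltW xb) (continuous_subspaceT continuous_force).
have m0 : 0 < derive1 V c.
  move: cb; rewrite in_itv/= => /andP[xc _].
  by apply: force_gt0; exact: lt_le_trans xc.
have tail : (\int[mu]_(q in `[x, b[) (slowness q)%:E < +oo)%E.
  apply: le_lt_trans (integral_slowness_le _ _ m0 ax xb _) (ltry _).
  by move=> q qb; apply: Vc; rewrite in_itv.
have head : (\int[mu]_(q in `[a, x[) (slowness q)%:E < +oo)%E.
  have : mu.-integrable `[a, x] (EFin \o slowness).
    apply: continuous_compact_integrable; first exact: segment_compact.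
    apply: continuous_in_subspaceT => q; rewrite inE/= => /itvP qx.
    by apply: continuous_slowness; rewrite qx (le_lt_trans _ xb)// qx.
  move=> /integrableP[ms]; apply: le_lt_trans.
  apply: (@le_trans _ _ (\int[mu]_(q in `[a, x]) (slowness q)%:E)%E).
    apply: ge0_subset_integral => //.
      by move=> q _; rewrite lee_fin.
    by apply: subset_itvl; rewrite bnd_simp.
  apply: ge0_le_integral => //=.
  - by move=> q _; rewrite lee_fin.
  - move/measurable_EFinP : ms => ms.
    exact/measurable_EFinP/measurableT_comp.
  - by move=> q _; rewrite lee_fin ler_norm.
have mco : measurable_fun `[a, b[ (EFin \o slowness).
  apply/measurable_EFinP; apply: measurable_funS measurable_slowness => //.
  by apply: subset_itvl; rewrite bnd_simp.
apply/integrableP; split; first exact/measurable_EFinP.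
have -> : (\int[mu]_(q in `[a, b]) `|(EFin \o slowness) q| =
    \int[mu]_(q in `[a, b[) (slowness q)%:E)%E.
  rewrite integral_itv_bndo_bndc//.
  by apply: eq_integral => q _ /=; rewrite ger0_norm.
have ab : `[a, b[%classic = `[a, x[%classic `|` `[x, b[%classic.
  by rewrite -itv_bndbnd_setU ?bnd_simp// ltW.
rewrite ab ge0_integral_setU//.
- exact: lte_add_pinfty.
- by rewrite -ab.
- by move=> q _; rewrite lee_fin.
- rewrite disj_set2E; apply/eqP/seteqP; split=> q //= [].
  by rewrite !in_itv/=; lra.
Qed.

(** Since V >= 0, the speed is at most sqrt (2 e). *)
Lemma slowness_integral_gt0 : 0 < \int[mu]_(q in `[a, b]) slowness q.
Proof.
pose k := (Num.sqrt (2 * e))^-1.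
have k0 : 0 < k by rewrite invr_gt0 sqrtr_gt0 mulr_gt0.
apply: (@lt_le_trans _ _ (\int[mu]_(q in `[a, b[) k)).
  rewrite Rintegral_cst//= lebesgue_measure_itv/= lte_fin a_lt /= mulr_gt0//.
  by rewrite subr_gt0.
have int_co : mu.-integrable `[a, b[ (EFin \o slowness).
  apply: integrableS slowness_integrable => //.
  by apply: subset_itvl; rewrite bnd_simp.
rewrite -Rintegral_itv_bndo_bndc//; apply: le_Rintegral => //.
  apply: integrableS (_ : mu.-integrable `[a, b] _) => //.
    by apply: subset_itvl; rewrite bnd_simp.
  apply: continuous_compact_integrable; first exact: segment_compact.
  by apply: continuous_subspaceT => ?; exact: cvg_cst.
move=> q; rewrite /= in_itv/= => qb.
rewrite lef_pV2 ?posrE ?speed_gt0// ?sqrtr_gt0 ?mulr_gt0// ler_wsqrtr//.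
by rewrite ler_pM2l// gerBl potential_ge0.
Qed.

End Impact.

Lemma impact_period_gt0 e a :
  V a < e -> a < qmax V e -> 0 < impact_period V e a.
Proof.
by move=> Va a_lt; rewrite /impact_period mulr_gt0// slowness_integral_gt0.
Qed.

(** The integral from 0 to a moving wall is continuous in the wall because the
    integrand is integrable up to q^max; the impact time is its complement. *)
Lemma impact_period_surj e t : 0 < e -> 0 < t < impact_period V e 0 ->
  exists q, [/\ 0 < q, V q < e & impact_period V e q = t].
Proof.
move=> e0 /andP[t0 tI]; have [b0 Vb] := qmaxP e e0.
have V0 : V 0 < e by rewrite potential0.
pose f := fun q => (Num.sqrt (2 * (e - V q)))^-1.
have fint : lebesgue_measure.-integrable `[0, qmax V e] (EFin \o f).
  exact: slowness_integrable.
have cP := parameterized_integral_continuous (ltW b0) fint.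
set I := \int[lebesgue_measure]_(q in `[0, qmax V e]) f q.
have IE : impact_period V e 0 = 2 * I by [].
have P0 : parameterized_integral lebesgue_measure 0 0 f = 0.
  by rewrite /parameterized_integral set_itv1 Rintegral_set1.
have Pb : parameterized_integral lebesgue_measure 0 (qmax V e) f = I by [].
have [|q] := @IVT _ _ _ _ (I - t / 2) (ltW b0) cP.
  by rewrite P0 Pb min_l ?max_r; lra.
rewrite in_itv/= => /andP[q0 qb] qI.
have {}q0 : 0 < q.
  rewrite lt_neqAle q0 andbT; apply/eqP => qE; move: qI; rewrite -qE P0; lra.
have {}qb : q < qmax V e.
  rewrite lt_neqAle qb andbT; apply/eqP => qE; move: qI; rewrite qE Pb; lra.
exists q; split=> //; first by rewrite -[ltRHS]Vb potential_incr// ltW.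
rewrite /impact_period -/f.
have split_q := @Rintegral_itvB _ f (BLeft 0) (BRight (qmax V e)) q fint.
rewrite -Rintegral_itv_obnd_cbnd.
  rewrite -split_q ?bnd_simp ?ltW//; rewrite /parameterized_integral in qI.
  by rewrite -/I qI; lra.
by apply: integrableS fint => //; apply: subset_itvr; rewrite bnd_simp ltW.
Qed.

End Potential.

(** * Inverses and primitives on the whole line *)

Section Inverse.
Context {R : realType}.

Lemma is_derive_continuous (f df : R -> R) :
  (forall x, is_derive x (1 : R) f (df x)) -> continuous f.
Proof.
move=> fdf x; apply/differentiable_continuous/derivable1_diffP.
by have [] := fdf x.
Qed.

Lemma is_derive_incr (f df : R -> R) :
  (forall x, is_derive x (1 : R) f (df x)) -> (forall x, 0 < df x) ->
  {homo f : x y / x < y}.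
Proof.
move=> fdf df0 x y xy; have fc := is_derive_continuous _ _ fdf.
have [c _ fE] := MVT xy (fun z _ => fdf z) (continuous_subspaceT fc).
by rewrite -subr_gt0 fE mulr_gt0 ?subr_gt0.
Qed.

Lemma increasing_inverse (f df : R -> R) :
  (forall x, is_derive x (1 : R) f (df x)) -> (forall x, 0 < df x) ->
  (forall s, exists a b, f a <= s <= f b) ->
  exists h : R -> R, [/\ cancel f h, cancel h f &
    forall s, is_derive s (1 : R) h (df (h s))^-1].
Proof.
move=> fdf df0 fab; have fc := is_derive_continuous _ _ fdf.
have finc := is_derive_incr _ _ fdf df0.
have fmono : {mono f : x y / x <= y} := le_mono finc.
have /choice[h hK] : forall s, exists x, f x = s.
  move=> s; have [a [b /andP[fas sfb]]] := fab s.
  have ab : a <= b by rewrite -fmono (le_trans fas).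
  have [|x _ xs] := IVT ab (continuous_subspaceT fc) (v := s).
    by rewrite min_l ?fmono// max_r ?fmono// fas.
  by exists x.
have fK : cancel f h by move=> x; apply: (inc_inj fmono); rewrite hK.
exists h; split=> // s; rewrite -{1}(hK s).
apply: is_derive_inverse; last exact: lt0r_neq0.
- by apply: (@nearW _ (nbhs (h s))) => x; exact: fK.
- by apply: (@nearW _ (nbhs (h s))) => x; exact: fc.
Qed.

(** The primitive is the integral from 0 to x. Derivatives of integrals are
    available for an interval with a fixed left end, so near each point the
    primitive is compared with an integral that starts further left. *)
Lemma continuous_antiderivative (f : R -> R) : continuous f ->
  exists F : R -> R, forall x, is_derive x (1 : R) F (f x).
Proof.
move=> fc.
have fint a b : lebesgue_measure.-integrable `[a, b] (EFin \o f).
  apply: continuous_compact_integrable; first exact: segment_compact.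
  exact: continuous_subspaceT.
(* at most one of the two intervals is nonempty *)
pose F x := \int[lebesgue_measure]_(t in `]0, x]) f t
          - \int[lebesgue_measure]_(t in `]x, 0]) f t.
exists F => x0; pose a := - `|x0| - 1.
have a0 : a < 0 by rewrite /a; have := normr_ge0 x0; lra.
have ax : a < x0 by rewrite /a; have := ler_norm (- x0); rewrite normrN; lra.
pose G x := \int[lebesgue_measure]_(t in `[a, x]) f t.
have FG : \near x0, G x0 - G 0 = F x0.
  near=> x; have axx : a < x by near: x; exact: lt_nbhsr.
  rewrite /F /G; have [x0le|x0le] := leP 0 x.
    rewrite (_ : [set` `]x, 0]] = set0) ?Rintegral_set0 ?subr0; last first.
      by apply: set_itv_ge; rewrite bnd_simp -leNgt.
    by apply: Rintegral_itvB; rewrite ?bnd_simp// ltW.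
  rewrite (_ : [set` `]0, x]] = set0) ?Rintegral_set0 ?sub0r; last first.
    by apply: set_itv_ge; rewrite bnd_simp -leNgt ltW.
  apply: (@oppr_inj R); rewrite opprB opprK.
  by apply: Rintegral_itvB; rewrite ?bnd_simp// ltW.
apply: (near_eq_is_derive FG).
have [dG GE] := continuous_FTC1_closed (ltr_pwDr ltr01 (lexx x0)) (fint _ _) ax (fc x0).
have dGx : is_derive x0 (1 : R) G (f x0).
  by apply: DeriveDef => //; rewrite -derive1E.
by apply: is_derive_eq; rewrite subr0.
Unshelve. all: by end_near. Qed.

End Inverse.

(** * Periodic motions *)

Section Action.
Context {R : realType}.
Variable V : R -> R.
Hypothesis hV : admissible_potential V.

Let k := derive1n 2 V 0.
Let k0 : 0 < k. Proof. by have [_ []] := hV. Qed.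

Let force0 : derive1 V 0 = 0.
Proof.
have dV := is_derive_potential V hV.
have [] := @derive1_at_min R V (-1) 1 0 _ _ _ _.
- by lra.
- by move=> x _; have [] := dV x.
- by rewrite in_itv/= ltrN10 ltr01.
- by move=> x _; rewrite (potential0 V hV) (potential_ge0 V hV).
- by move=> _; rewrite derive1E.
Qed.

(** With their limits at the minimum as values at 0, these two quotients are
    continuous and positive: this is where V''(0) > 0 is used. *)
Let ratio q := if q == 0 then k else 2 * V q / q ^+ 2.
Let stiffness q := if q == 0 then k else derive1 V q / q.

Let ratio_gt0 q : 0 < ratio q.
Proof.
rewrite /ratio; case: eqVneq => // q0.
by apply: divr_gt0; rewrite ?exprn_even_gt0// mulr_gt0 ?(potential_gt0 V hV).
Qed.

Let stiffness_gt0 q : 0 < stiffness q.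
Proof.
rewrite /stiffness; case: eqVneq => // q0.
have [_ _ sV _ _] := hV.
have -> : derive1 V q / q = q * derive1 V q / q ^+ 2 by field.
by rewrite divr_gt0 ?sV// exprn_even_gt0.
Qed.

Let stiffnessE q : derive1 V q = q * stiffness q.
Proof.
rewrite /stiffness; case: eqVneq => [->|q0]; first by rewrite force0 mul0r.
by rewrite mulrC divfK.
Qed.

Let ratioE q : 2 * V q = q ^+ 2 * ratio q.
Proof.
rewrite /ratio; case: eqVneq => [->|q0].
  by rewrite (potential0 V hV) expr0n/= mulr0 mul0r.
by rewrite [RHS]mulrC divfK// expf_neq0.
Qed.

Let continuous_at_neq0 (f g : R -> R) q : q != 0 ->
  (forall x, x != 0 -> f x = g x) ->
  {for q, continuous g} -> {for q, continuous f}.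
Proof.
move=> q0 fg cg; rewrite /prop_for /continuous_at (fg _ q0).
have nz : nbhs q [set x : R | x != 0].
  by apply: open_nbhs_nbhs; split=> //; exact: open_neq.
apply: cvg_trans cg; apply: near_eq_cvg; near=> x; rewrite fg//.
by near: x.
Unshelve. all: by end_near. Qed.

Let continuous_stiffness : continuous stiffness.
Proof.
move=> q; have [->|q0] := eqVneq q 0; last first.
  apply: (continuous_at_neq0 _ (fun q => derive1 V q / q)) => //.
    by move=> x /negbTE x0; rewrite /stiffness x0.
  apply: cvgM; first exact: continuous_force.
  by apply: cvgV => //; exact: cvg_id.
have dV' : is_derive (0 : R) (1 : R) (derive1 V) k.
  have [dV _ _ _ _] := hV.
  by apply: DeriveDef; [exact: (dV 1%N)|rewrite -derive1E].
have [G [GE Gc G0]] := (is_derive1_caratheodory _ _ _).1 dV'.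
have -> : stiffness = G; last by [].
apply/funext => x; rewrite /stiffness.
case: eqVneq => [->|x0]; first by rewrite G0.
by have := GE x; rewrite force0 !subr0 => ->; rewrite mulfK.
Qed.

Let continuous_ratio : continuous ratio.
Proof.
move=> q; have [->|q0] := eqVneq q 0; last first.
  apply: (continuous_at_neq0 _ (fun q => 2 * V q / q ^+ 2)) => //.
    by move=> x /negbTE x0; rewrite /ratio x0.
  apply: cvgM; first by apply: cvgMr; exact: continuous_potential.
  by apply: cvgV; [rewrite expf_neq0|exact: exprn_continuous].
have lh : (2 * V x / x ^+ 2) @[x --> (0 : R)^'] --> k.
  have dg x : x \in (`]-1, 1[ `\ (0 : R))%classic -> x != 0.
    by rewrite inE/= => -[_ /eqP].
  (* l'Hopital's rule reads the quotient of derivatives also at 0, where both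
     of them are free: 1 and k give it its limit as value *)
  apply: (@lhopital R (fun x => 2 * V x)
     (fun x => if x == 0 then k else 2 * derive1 V x)
     (fun x => x ^+ 2) (fun x => if x == 0 then 1 else 2 * x) (-1) 1 0 k).
  - by rewrite in_itv/= ltrN10 ltr01.
  - move=> x /dg/negbTE ->; have dV := is_derive_potential V hV x.
    by apply: is_derive_eq; rewrite /GRing.scale/=; ring.
  - move=> x /dg/negbTE ->; apply: is_derive_eq; rewrite /GRing.scale/=; ring.
  - have cV : V x @[x --> (0 : R)] --> V 0 := continuous_potential V hV 0.
    rewrite (potential0 V hV) in cV.
    by rewrite -[X in _ --> X](mulr0 2); exact: cvgMr.
  - by have := @exprn_continuous R 2 0; rewrite /continuous_at expr0n.
  - by move=> x /dg x0; rewrite (negbTE x0) mulf_neq0.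
  - rewrite [X in X @ _ --> _](_ : _ = stiffness).
      by have := continuous_stiffness 0; rewrite /continuous_at /stiffness eqxx.
    apply/funext => x; rewrite /stiffness; case: eqVneq => // [_|x0].
      by rewrite divr1.
    by field.
apply/continuous_withinNx; rewrite {2}/ratio eqxx; apply: cvg_trans lh.
apply: near_eq_cvg; near=> x; rewrite /ratio ifN//.
by near: x; exact: nbhs_dnbhs_neq.
Unshelve. all: by end_near. Qed.

(** The coordinate sign(q) sqrt (2 V(q)) that makes the potential quadratic;
    in this factorized form it is visibly differentiable at 0. Its derivative
    is [slope]. *)
Let level q := q * Num.sqrt (ratio q).
Let slope q := stiffness q / Num.sqrt (ratio q).

Let sqrt_ratio_gt0 q : 0 < Num.sqrt (ratio q).
Proof. by rewrite sqrtr_gt0. Qed.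

Let slope_gt0 q : 0 < slope q. Proof. exact: divr_gt0. Qed.

Let level_slope q : level q * slope q = derive1 V q.
Proof. rewrite stiffnessE /level /slope; field; exact: lt0r_neq0. Qed.

Let levelE q : level q ^+ 2 = 2 * V q.
Proof. by rewrite exprMn sqr_sqrtr ?ratioE// ltW. Qed.

Let continuous_sqrt_ratio : continuous (fun q => Num.sqrt (ratio q)).
Proof.
move=> q; apply: (@continuous_comp _ _ _ ratio Num.sqrt).
  exact: continuous_ratio.
exact: sqrt_continuous.
Qed.

Let continuous_slope : continuous slope.
Proof.
move=> q; apply: cvgM; first exact: continuous_stiffness.
by apply: cvgV; [exact: lt0r_neq0|exact: continuous_sqrt_ratio].
Qed.

Let level_sqrt (s y : R) :
  s ^+ 2 = 1 -> 0 < s * y -> level y = s * Num.sqrt (2 * V y).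
Proof.
move=> s2 sy; rewrite -levelE sqrtr_sqr normrM (gtr0_norm (sqrt_ratio_gt0 y)).
have -> : `|y| = s * y.
  rewrite -(gtr0_norm sy) normrM; suff -> : `|s| = 1 by rewrite mul1r.
  by apply/eqP; rewrite -sqrp_eq1// real_normK ?num_real// s2.
by rewrite !mulrA -expr2 s2 mul1r.
Qed.

(** At 0 the increment of [level] is already in factorized form. Elsewhere
    [level] is locally a constant sign times sqrt (2 V). *)
Let is_derive_level q : is_derive q (1 : R) level (slope q).
Proof.
have [->|q0] := eqVneq q 0.
  apply/is_derive1_caratheodory; exists (fun q => Num.sqrt (ratio q)); split.
  - by move=> z; rewrite /level mul0r !subr0 mulrC.
  - exact: continuous_sqrt_ratio.
  - rewrite /slope /stiffness {2}/ratio /ratio eqxx.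
    by rewrite -{2}(@sqr_sqrtr _ k) ?(ltW k0)// expr2 mulfK// lt0r_neq0// sqrtr_gt0.
pose s := Num.sg q.
have s2 : s ^+ 2 = 1 by rewrite /s sqr_sg q0.
have sq : 0 < s * q by rewrite /s -normrEsg normr_gt0.
have near_s : \near q, s * Num.sqrt (2 * V q) = level q.
  near=> y; apply/esym/level_sqrt => //; near: y.
  have : s * y @[y --> q] --> s * q by apply: cvgMr; exact: cvg_id.
  by move/cvgr_gt; apply.
apply: (near_eq_is_derive near_s).
have dV := is_derive_potential V hV q.
have V0 : 0 < 2 * V q by rewrite mulr_gt0 ?(potential_gt0 V hV).
have dh : is_derive q (1 : R) (fun q => 2 * V q) (2 * derive1 V q).
  by apply: is_derive_eq; rewrite /GRing.scale/=; ring.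
have ds := @is_derive1_comp R Num.sqrt (fun q => 2 * V q) q _ _
  (is_derive1_sqrt V0) dh.
have dsq : is_derive q (1 : R) (fun q => Num.sqrt (2 * V q)) _ := ds.
apply: is_derive_eq; rewrite -level_slope (level_sqrt _ _ s2 sq) /GRing.scale/=.
have r0 : Num.sqrt (2 * V q) != 0 by rewrite lt0r_neq0// sqrtr_gt0.
rewrite -[RHS]mul1r -[in RHS]s2; move: r0; set z := Num.sqrt _ => z0.
by field.
Unshelve. all: by end_near. Qed.

Let level_surj t : exists a b, level a <= t <= level b.
Proof.
have [_ _ _ Vy VNy] := hV.
have [b [b0 tb]] : exists b, 0 < b /\ t ^+ 2 <= 2 * V b.
  move/cvgryPge : Vy => /(_ (t ^+ 2 / 2))[M [Mr MV]].
  exists (Num.max (M + 1) 1); rewrite lt_max ltr01 orbT; split=> //.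
  rewrite mulrC -ler_pdivrMr//.
  by apply: MV; rewrite lt_max ltrDl ltr01.
have [a [a0 ta]] : exists a, a < 0 /\ t ^+ 2 <= 2 * V a.
  move/cvgryPge : VNy => /(_ (t ^+ 2 / 2))[M [Mr MV]].
  exists (Num.min (M - 1) (- 1)); rewrite gt_min ltrN10 orbT; split=> //.
  rewrite mulrC -ler_pdivrMr//.
  by apply: MV; rewrite gt_min gtrDl ltrN10.
exists a, b; rewrite (level_sqrt 1 b) ?expr1n ?mul1r//.
rewrite (level_sqrt (-1) a) ?sqrrN ?expr1n ?mulN1r ?oppr_gt0//.
apply/andP; split.
  rewrite lerNl; apply: le_trans (ler_norm _) _.
  by rewrite normrN -sqrtr_sqr ler_wsqrtr.
by apply: le_trans (ler_norm _) _; rewrite -sqrtr_sqr ler_wsqrtr.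
Qed.

(** In the coordinates (level(q), p) the energy level is the circle of radius
    r = sqrt (2 e), run through at the angular speed W(phi) = slope(q) > 0. The
    time S as a function of the angle is a primitive of 1 / W; it grows by the
    constant T at each turn, hence is onto, and its inverse is the motion. The
    period T is the least one because cos phi returns to its initial value 1
    only after a full turn. *)
Lemma exists_motion e : 0 < e ->
  exists q p T, hamiltonian_motion V e q p /\ least_period q p T.
Proof.
move=> e0; pose r := Num.sqrt (2 * e).
have r0 : 0 < r by rewrite sqrtr_gt0 mulr_gt0.
have [x [levelK xK dx]] :=
  increasing_inverse _ _ is_derive_level slope_gt0 level_surj.
have xc : continuous x by exact: is_derive_continuous dx.
pose W phi := slope (x (r * sin phi)).
have W0 phi : 0 < W phi by exact: slope_gt0.
have Wc : continuous W.
  move=> phi; apply: (@continuous_comp _ _ _ (fun phi => x (r * sin phi)) slope);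
    last exact: continuous_slope.
  apply: (@continuous_comp _ _ _ (fun phi => r * sin phi) x); last exact: xc.
  by apply: cvgMr; exact: continuous_sin.
have [S0 dS0] : exists S, forall phi, is_derive phi (1 : R) S (W phi)^-1.
  apply: (continuous_antiderivative (fun phi => (W phi)^-1)) => phi.
  by apply: cvgV; [exact: lt0r_neq0|exact: Wc].
pose S phi := S0 phi - S0 0.
have dS phi : is_derive phi (1 : R) S (W phi)^-1.
  by have dS0phi := dS0 phi; apply: is_derive_eq; rewrite subr0.
have W'0 phi : 0 < (W phi)^-1 by rewrite invr_gt0.
have S00 : S 0 = 0 by rewrite /S subrr.
have Sinc := is_derive_incr _ _ dS W'0.
pose T := S (2 * pi).
have T0 : 0 < T by rewrite -S00; apply: Sinc; rewrite mulr_gt0 ?pi_gt0.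
have SD phi : S (phi + 2 * pi) = S phi + T.
  have dD y : is_derive y (1 : R) (fun phi => S (phi + 2 * pi) - S phi) 0.
    have d1 : is_derive y (1 : R) (fun phi : R => phi + 2 * pi) 1.
      by apply: is_derive_eq; rewrite addr0.
    have d2 := @is_derive1_comp R S (fun phi => phi + 2 * pi) y _ _ (dS _) d1.
    have d3 : is_derive y (1 : R) (fun phi => S (phi + 2 * pi)) _ := d2.
    have dSy := dS y.
    apply: is_derive_eq; rewrite mulr1 /W.
    by rewrite mulrDl mul1r -[pi + pi]mulr2n sinD2pi subrr.
  have := is_derive_0_is_cst phi 0 dD; rewrite add0r S00 subr0 -/T => <-.
  by rewrite [RHS]addrC subrK.
have SDn n : S (n%:R * (2 * pi)) = n%:R * T.
  elim: n => [|n IH]; first by rewrite !mul0r.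
  have e1 : n.+1%:R * (2 * pi) = n%:R * (2 * pi) + 2 * pi :> R.
    by rewrite -natr1; ring.
  by rewrite e1 SD IH -natr1; ring.
have SDNn n : S (- (n%:R * (2 * pi))) = - (n%:R * T).
  elim: n => [|n IH]; first by rewrite !mul0r oppr0.
  have e1 : - (n.+1%:R * (2 * pi)) + 2 * pi = - (n%:R * (2 * pi)) :> R.
    by rewrite -natr1; ring.
  by apply: (@addIr _ T); rewrite -SD e1 IH -natr1; ring.
have Ssurj t : exists a b, S a <= t <= S b.
  pose n := (Num.truncn (`|t| / T)).+1.
  have nT : `|t| < n%:R * T by rewrite -ltr_pdivrMr//; exact: truncnS_gt.
  exists (- (n%:R * (2 * pi))), (n%:R * (2 * pi)); rewrite SDn SDNn.
  by move: nT; rewrite ltr_norml => /andP[/ltW -> /ltW ->].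
have [phi [SK phiK dphi]] := increasing_inverse _ _ dS W'0 Ssurj.
have phiD t : phi (t + T) = phi t + 2 * pi.
  by rewrite -[RHS]SK SD phiK.
pose q t := x (r * sin (phi t)); pose p t := r * cos (phi t).
have dphi' t : is_derive t (1 : R) phi (W (phi t)).
  by have dt := dphi t; apply: is_derive_eq; rewrite invrK.
exists q, p, T; split; split.
- move=> t; have dt := dphi' t.
  have d1 : is_derive t (1 : R) (fun t => r * sin (phi t))
      (r * cos (phi t) * W (phi t)).
    have d0 := @is_derive1_comp R sin phi t _ _ (is_derive_sin _) dt.
    have d0' : is_derive t (1 : R) (fun t => sin (phi t)) _ := d0.
    by apply: is_derive_eq; rewrite /GRing.scale/=; ring.
  have d2 := @is_derive1_comp R x (fun t => r * sin (phi t)) t _ _ (dx _) d1.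
  apply: (is_derive_eq d2); rewrite -/(W (phi t)) mulrC mulfK//.
  exact: lt0r_neq0.
- move=> t; have dt := dphi' t.
  have d0 := @is_derive1_comp R cos phi t _ _ (is_derive_cos _) dt.
  have d0' : is_derive t (1 : R) (fun t => cos (phi t)) _ := d0.
  apply: is_derive_eq; rewrite -level_slope /q xK -/(W (phi t)) /GRing.scale/=.
  by ring.
- move=> t; rewrite /q.
  have -> : V (x (r * sin (phi t))) = (r * sin (phi t)) ^+ 2 / 2.
    by rewrite -[in RHS](xK (r * sin (phi t))) levelE [RHS]mulrC mulKf.
  rewrite /p !exprMn -mulrDl -mulrDr cos2Dsin2 mulr1 sqr_sqrtr ?mulr_ge0 ?ltW//.
  by rewrite mulrC mulKf.
- exact: T0.
- move=> t; rewrite /q /p phiD.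
  by rewrite mulrDl mul1r -[pi + pi]mulr2n sinD2pi cosD2pi.
- move=> s s0 /(_ 0)[_]; rewrite /p add0r => /(mulfI (lt0r_neq0 r0)).
  have phi0 : phi 0 = 0 by rewrite -S00 SK.
  rewrite phi0 cos0 => c1; rewrite leNgt; apply/negP => sT.
  have phiinc : {homo phi : x y / x < y}.
    move=> u v uv; rewrite ltNge; apply/negP => vu.
    have : S (phi v) <= S (phi u).
      by move: vu; rewrite le_eqVlt => /predU1P[->//|/Sinc/ltW].
    by rewrite !phiK leNgt uv.
  have ps0 : 0 < phi s by rewrite -phi0; exact: phiinc.
  have ps1 : phi s < 2 * pi by rewrite -[2 * pi]SK; exact: phiinc.
  have : 0 < sin (phi s / 2).
    by apply: sin_gt0_pi; rewrite divr_gt0// ltr_pdivrMr// mulrC.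
  suff : sin (phi s / 2) ^+ 2 = 0.
    by move/eqP; rewrite sqrf_eq0 => /eqP ->; rewrite ltxx.
  have := cosD (phi s / 2) (phi s / 2); rewrite -splitr c1 -!expr2.
  have := cos2Dsin2 (phi s / 2); lra.
Qed.

Lemma period_gt0 e : 0 < e -> 0 < period V e.
Proof.
move=> e0; have [q [p [T hT]]] := exists_motion e e0.
rewrite /period; case: xgetP => [T' -> [q' [p' [_ []]]] //|/(_ T)].
by move=> H; exfalso; apply: H; exists q, p.
Qed.

End Action.

(** * Resonant level sets of the step system *)

Section Step.
Context {R : realType}.
Variables V1 V2 : R -> R.
Hypotheses (hV1 : admissible_potential V1) (hV2 : admissible_potential V2).

(** Cancelling a common factor of m and n only weakens the bound on the wall. *)
Lemma resonant_level_reduced (q1wall q2wall h e1 : R) (m n : nat) :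
  resonant_level V1 V2 q1wall q2wall h e1 m n ->
  exists m' n' : nat, [/\ (0 < m')%N, (0 < n')%N, coprime m' n',
    Theta2 V1 V2 q1wall e1 (h - e1) = 2 * pi * m'%:R / n'%:R &
    2 * theta2wall V2 q2wall (h - e1) < 2 * pi / n'%:R].
Proof.
move=> [_ _ [m0 n0] TE wlt].
have g0 : (0 < gcdn m n)%N by rewrite gcdn_gt0 m0.
have mE : m = (m %/ gcdn m n * gcdn m n)%N by rewrite divnK// dvdn_gcdl.
have nE : n = (n %/ gcdn m n * gcdn m n)%N by rewrite divnK// dvdn_gcdr.
have n'0 : (0 < n %/ gcdn m n)%N by rewrite divn_gt0// dvdn_leq// dvdn_gcdr.
exists (m %/ gcdn m n)%N, (n %/ gcdn m n)%N; split=> //.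
- by rewrite divn_gt0// dvdn_leq// dvdn_gcdl.
- by rewrite /coprime -(eqn_pmul2r g0) muln_gcdl -mE -nE mul1n.
- have mR : m%:R = (m %/ gcdn m n)%:R * (gcdn m n)%:R :> R by rewrite -natrM -mE.
  have nR : n%:R = (n %/ gcdn m n)%:R * (gcdn m n)%:R :> R by rewrite -natrM -nE.
  by rewrite TE mR nR; field; rewrite !pnatr_eq0 -!lt0n n'0.
- apply: (lt_le_trans wlt); rewrite ler_pM2l ?mulr_gt0 ?pi_gt0//.
  by rewrite lef_pV2 ?posrE ?ltr0n// ler_nat leq_div.
Qed.

Lemma theta2wall_gt0 (q2wall h e1 : R) : V2 q2wall < h - e1 ->
  0 < theta2wall V2 q2wall (h - e1).
Proof.
move=> Ve; have e0 : 0 < h - e1 := le_lt_trans (potential_ge0 V2 hV2 _) Ve.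
have [b0 Vb] := qmaxP V2 hV2 _ e0.
rewrite /theta2wall mulr_gt0 ?pi_gt0// divr_gt0 ?period_gt0// impact_period_gt0//.
rewrite ltNge; apply/negP; rewrite le_eqVlt => /predU1P[bE|bq].
  by move: Ve; rewrite -bE Vb ltxx.
by have := potential_incr V2 hV2 _ _ (ltW b0) bq; rewrite Vb ltNge (ltW Ve).
Qed.

(** With m = 1, the first wall is fixed by the resonance. The second one then
    realizes every large value of chi_2, since its impact time can be any small
    positive number; the integer K absorbs what large means. *)
Lemma resonance_realizable (c : R) : 0 <= c ->
  exists (q1wall q2wall h e1 : R) (m n : nat) (K : int),
    resonant_level V1 V2 q1wall q2wall h e1 m n /\
    chi2 V1 V2 q1wall q2wall e1 (h - e1) = c + K%:~R.
Proof.
move=> c0; set T1 := period V1 1; set T2 := period V2 1.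
have T10 : 0 < T1 by exact: period_gt0.
have T20 : 0 < T2 by exact: period_gt0.
have [b10 _] := qmaxP V1 hV1 1 ltr01; have [b20 _] := qmaxP V2 hV2 1 ltr01.
have I10 : 0 < impact_period V1 1 0.
  by apply: impact_period_gt0; rewrite // (potential0 V1 hV1).
have I20 : 0 < impact_period V2 1 0.
  by apply: impact_period_gt0; rewrite // (potential0 V2 hV2).
pose M1 := Num.min (impact_period V1 1 0) T1.
have M10 : 0 < M1 by rewrite lt_min I10.
pose n := (Num.truncn (T2 / M1)).+1.
have n0 : 0 < n%:R :> R by rewrite ltr0n.
have : T2 / n%:R < M1.
  by rewrite ltr_pdivrMr// mulrC -ltr_pdivrMr//; exact: truncnS_gt.
rewrite lt_min => /andP[nI1 nT1]; clearbody n.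
have [|q1 [q10 Vq1 q1E]] := impact_period_surj V1 hV1 1 (T2 / n%:R) ltr01.
  by rewrite divr_gt0.
pose M2 := Num.min (impact_period V2 1 0) (T2 / n%:R).
have M20 : 0 < M2 by rewrite lt_min I20 divr_gt0.
pose d := T1 - T2 / n%:R.
have d0 : 0 < d by rewrite subr_gt0.
pose K := (Num.truncn (d / M2)).+1.
have cK0 : 0 < c + K%:R by rewrite ltr_wpDl// ltr0n.
have : d / (c + K%:R) < M2.
  rewrite ltr_pdivrMr// mulrC -ltr_pdivrMr//.
  by apply: lt_le_trans (truncnS_gt _) _; rewrite lerDr.
rewrite lt_min => /andP[dI2 dn]; clearbody K.
have [|q2 [q20 Vq2 q2E]] := impact_period_surj V2 hV2 1 (d / (c + K%:R)) ltr01.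
  by rewrite divr_gt0.
have h1 : 1 + 1 - 1 = 1 :> R by rewrite addrK.
exists q1, q2, (1 + 1), 1, 1%N, n, K%:Z; rewrite /resonant_level h1; split; first split.
- by rewrite mulf_neq0// lt0r_neq0.
- by rewrite /hstep /Rc /= Vq1 h1; split; [exact: ltrD|split=> //; lra].
- by split; rewrite // -(ltr0n R).
- by rewrite /Theta2 q1E -/T2; field; rewrite (lt0r_neq0 n0) (lt0r_neq0 T20).
- rewrite /theta2wall q2E -/T2 mulrA ltr_pM2l ?mulr_gt0 ?pi_gt0//.
  by rewrite ltr_pdivrMr// [ltRHS]mulrC.
- rewrite /chi2 q1E q2E -/T1 -/d -pmulrn; clearbody d. field.
  by rewrite (lt0r_neq0 cK0) (lt0r_neq0 d0).
Qed.

End Step.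

Lemma rationalDz (R : realType) (x : R) (z : int) :
  rational x -> rational (x + z%:~R).
Proof.
move=> [p _ <-]; exists (p + z%:~R) => //.
by rewrite rmorphD/= ratr_int.
Qed.

Theorem lemma5p3 (R : realType) (V1 V2 : R -> R)
    (hV1 : admissible_potential V1) (hV2 : admissible_potential V2) :
  (forall (q1wall q2wall h e1 : R) (m n : nat),
     resonant_level V1 V2 q1wall q2wall h e1 m n ->
     let F := return_map V1 V2 q1wall q2wall e1 (h - e1) in
     let chi := chi2 V1 V2 q1wall q2wall e1 (h - e1) in
     [/\ ~ ergodic F,
         ~ rational (fracpart chi) -> dense_on_arcs_periodic_off F
       & rational (fracpart chi) ->
           (forall x, circle x -> periodic_point F x) /\
           (fracpart chi != 0 -> two_periods F)]) /\
  (exists (q1wall q2wall h e1 : R) (m n : nat),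
     resonant_level V1 V2 q1wall q2wall h e1 m n /\
     ~ rational (fracpart (chi2 V1 V2 q1wall q2wall e1 (h - e1)))) /\
  (exists (q1wall q2wall h e1 : R) (m n : nat),
     [/\ resonant_level V1 V2 q1wall q2wall h e1 m n,
         rational (fracpart (chi2 V1 V2 q1wall q2wall e1 (h - e1)))
       & fracpart (chi2 V1 V2 q1wall q2wall e1 (h - e1)) != 0]).
Proof.
split; last split.
- move=> q1wall q2wall h e1 m n hlev F chi.
  have [m' [n' [m0 n0 mn TE wlt]]] := resonant_level_reduced _ _ _ _ _ _ _ _ hlev.
  have w0 : 0 < theta2wall V2 q2wall (h - e1).
    apply: theta2wall_gt0 => //; have [_ [_ [/= /andP[_ e1h] _]] _ _ _] := hlev.
    lra.
  have FE : F = exchange (2 * pi * m'%:R / n'%:R)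
      (theta2wall V2 q2wall (h - e1)) chi by rewrite /F /return_map TE.
  rewrite FE; split.
  + exact: exchange_not_ergodic.
  + exact: exchange_dense.
  + by move=> ratf; split; [exact: exchange_periodic|exact: exchange_two_periods].
- have [q1 [q2 [h [e1 [m [n [K [hlev chiE]]]]]]]] :=
    resonance_realizable V1 V2 hV1 hV2 pi (pi_ge0 R).
  exists q1, q2, h, e1, m, n; split=> //; rewrite chiE fracpartDz => ratf.
  by apply: (@pi_irrationnal R); rewrite (fracpartE pi); exact: rationalDz.
- have [|q1 [q2 [h [e1 [m [n [K [hlev chiE]]]]]]]] :=
    resonance_realizable V1 V2 hV1 hV2 2^-1; first by rewrite invr_ge0.
  exists q1, q2, h, e1, m, n; rewrite chiE fracpartDz.
  have -> : fracpart 2^-1 = 2^-1 :> R.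
    by apply: (@fracpart_def _ _ 0); rewrite ?addr0// invr_ge0 ler0n invf_lt1 ?ltr1n.
  split=> //.
  by apply/rationalP; exists 1, 2%N; rewrite mul1r.
Qed.
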